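(* Let $\phi(x)=\frac{ax+b}{cx+d}$ with $a,b,c,d\in\mathbb{Q}_2$, $ad-bc\ne0$, let $\Delta=(d-a)^2+4bc$ with $\sqrt{\Delta}\notin\mathbb{Q}_2$, and suppose that $\lambda=\frac{a+d+\sqrt{\Delta}}{a+d-\sqrt{\Delta}}$ is not a root of unity and that $\mathbb{Q}_2(\sqrt{\Delta})=\mathbb{Q}_2(\sqrt{i})$ where $i=2,-2,6$ or $-6$. Let $r_0=|\sqrt{\Delta}/c|_2$, let $\eta\in\mathbb{Q}_2$ with $|\eta|_2=\sqrt{2}\,r_0$, and set $h(x)=\eta x+\frac{a-d}{2c}$. If $(B,\phi)$ is a minimal subsystem of $(\mathbb{P}^1(\mathbb{Q}_2),\phi)$, then the unique invariant (Borel probability) measure $\overline\sigma$ of the system $(B,\phi)$ is given, for each measurable subset $A\subset B$, by $$\overline\sigma(A)=\frac{\overline\mu(h^{-1}(A))}{\overline\mu(h^{-1}(B))}.$$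
   Context: $\mathbb{P}^1(\mathbb{Q}_2)=\mathbb{Q}_2\cup\{\infty\}$ with its usual compact topology; $|\cdot|_2$ is extended to $\mathbb{Q}_2(\sqrt\Delta)$; $h$ is extended by $h(\infty)=\infty$. (The hypothesis $\sqrt\Delta\notin\mathbb{Q}_2$ forces $c\ne 0$.) A subsystem is a pair $(B,\phi)$ with $B$ nonempty compact and $\phi(B)\subset B$; it is minimal if $B=\overline{\{\phi^n(x):n\ge0\}}$ for every $x\in B$. Let $\mu_0$ be the Haar probability measure on $\mathbb{Z}_2$ and $\xi:\mathbb{P}^1(\mathbb{Q}_2)\to\mathbb{P}^1(\mathbb{Q}_2)$, $\xi(z)=1/z$. For a Borel set $S\subset\mathbb{P}^1(\mathbb{Q}_2)$ put $S_1=\mathbb{Z}_2\cap S$, $S_2=(\mathbb{P}^1(\mathbb{Q}_2)\setminus\mathbb{Z}_2)\cap S$ (so $\xi^{-1}(S_2)\subset 2\mathbb{Z}_2$), and define the probability measure $$\overline\mu(S):=\frac12\mu_0(S_1)+\mu_0(\xi^{-1}(S_2)).$$ *)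

(* Defs.v *)
From HB Require Import structures.
From mathcomp Require Import all_boot all_order all_algebra all_field.
From mathcomp Require Import generic_quotient ring_quotient.
From mathcomp Require Import all_classical all_reals all_analysis.
From mathcomp Require Import ring.

Set Implicit Arguments.
Unset Strict Implicit.
Unset Printing Implicit Defensive.

Import Order.TTheory GRing.Theory Num.Theory.

Local Open Scope classical_set_scope.
Local Open Scope ring_scope.

Definition rabs2 (x : rat) : rat :=
  if x == 0 then 0
  else 2 ^+ logn 2 `|denq x|%N / 2 ^+ logn 2 `|numq x|%N.

Lemma rabs2_0 : rabs2 0 = 0. Proof. by rewrite /rabs2 eqxx. Qed.

Lemma rabs2_frac (n d : int) : n != 0 -> d != 0 ->
  rabs2 (n%:~R / d%:~R) = 2 ^+ logn 2 `|d|%N / 2 ^+ logn 2 `|n|%N.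
Proof.
case: divqP => [_ _|k x k0 n0 d0]; first by rewrite eqxx.
have x0 : x != 0 by apply: contra_neq n0 => ->; rewrite mulr0.
rewrite /rabs2 (negPf x0) !abszM !lognM ?absz_gt0 ?numq_eq0 ?denq_eq0//.
by rewrite !exprD -mulf_div divff ?mul1r// expf_neq0.
Qed.

Lemma rabs2_frac_ex (x : rat) : x != 0 ->
  exists n d : int, [/\ n != 0, d != 0 & x = n%:~R / d%:~R].
Proof.
move=> x0; exists (numq x), (denq x).
by rewrite numq_eq0 x0 denq_eq0 divq_num_den.
Qed.

Lemma rabs2M x y : rabs2 (x * y) = rabs2 x * rabs2 y.
Proof.
have [->|x0] := eqVneq x 0; first by rewrite mul0r rabs2_0 mul0r.
have [->|y0] := eqVneq y 0; first by rewrite mulr0 rabs2_0 mulr0.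
have [n [d [n0 d0 ->]]] := rabs2_frac_ex x0.
have [m [e [m0 e0 ->]]] := rabs2_frac_ex y0.
rewrite mulf_div -!intrM !rabs2_frac ?mulf_neq0// mulf_div -!exprD.
by rewrite !abszM !lognM ?absz_gt0.
Qed.

Lemma rabs2_gt0 x : (0 < rabs2 x) = (x != 0).
Proof.
by rewrite /rabs2; case: eqVneq => //= _; rewrite divr_gt0// exprn_gt0.
Qed.

Lemma rabs2_ge0 x : 0 <= rabs2 x.
Proof.
have [->|x0] := eqVneq x 0; first by rewrite rabs2_0.
by rewrite ltW// rabs2_gt0.
Qed.

Lemma rabs2_eq0 x : (rabs2 x == 0) = (x == 0).
Proof. by have := rabs2_gt0 x; rewrite lt0r rabs2_ge0 andbT => /negb_inj. Qed.

Lemma rabs2_1 : rabs2 1 = 1.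
Proof.
have h : rabs2 1 != 0 by rewrite rabs2_eq0 oner_eq0.
by apply: (mulfI h); rewrite -rabs2M !mulr1.
Qed.

Lemma rabs2N x : rabs2 (- x) = rabs2 x.
Proof. by rewrite /rabs2 oppr_eq0 numqN denqN abszN. Qed.

Lemma rabs2B x y : rabs2 (x - y) = rabs2 (y - x).
Proof. by rewrite -rabs2N opprB. Qed.

Lemma rabs2V x : rabs2 x^-1 = (rabs2 x)^-1.
Proof.
have [->|x0] := eqVneq x 0; first by rewrite ?(invr0, rabs2_0).
have h : rabs2 x != 0 by rewrite rabs2_eq0.
by apply: (mulfI h); rewrite -rabs2M !divff// rabs2_1.
Qed.

Lemma rabs2_le1D x : rabs2 x <= 1 -> rabs2 (1 + x) <= 1.
Proof.
have [->|x0] := eqVneq x 0; first by rewrite addr0 rabs2_1.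
have [->|x10] := eqVneq (1 + x) 0; first by rewrite rabs2_0 ler01.
rewrite {1}/rabs2 (negPf x0) ler_pdivrMr ?exprn_gt0// mul1r => le_dn.
have {le_dn} le_dn : (logn 2 `|denq x| <= logn 2 `|numq x|)%N.
  by rewrite -(@ler_eXn2l rat 2).
have d0 : logn 2 `|denq x| = 0%N.
  move: le_dn (coprime_num_den x); rewrite lognE; case: ifP => // /and3P[_ _ hd].
  rewrite (lognE 2 `|numq x|); case: ifP => [/and3P[_ _ hn] _ cop|_]; last first.
    by rewrite ltnNge leq0n.
  by have := dvdn_gcd 2 `|numq x| `|denq x|; rewrite hd hn (eqP cop).
have -> : 1 + x = (denq x + numq x)%:~R / (denq x)%:~R.
  by rewrite intrD mulrDl divff ?intq_eq0 ?denq_eq0// divq_num_den.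
have [e|ne] := eqVneq (denq x + numq x) 0; first by rewrite e mul0r rabs2_0 ler01.
rewrite rabs2_frac ?denq_eq0// d0 expr0 ler_pdivrMr ?exprn_gt0// mul1r.
by rewrite exprn_ege1// ler1n.
Qed.

Lemma rabs2D x y : rabs2 (x + y) <= Num.max (rabs2 x) (rabs2 y).
Proof.
wlog yx : x y / rabs2 y <= rabs2 x => [h|].
  by have /orP[/h//|/h] := le_total (rabs2 y) (rabs2 x); rewrite addrC maxC.
rewrite max_l//; have [x0|x0] := eqVneq x 0.
  by rewrite x0 add0r -x0.
have -> : x + y = x * (1 + y / x) by rewrite mulrDr mulr1 mulrCA divff// mulr1.
rewrite rabs2M ler_piMr ?rabs2_ge0// rabs2_le1D// rabs2M rabs2V.
by rewrite ler_pdivrMr ?rabs2_gt0// mul1r.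
Qed.

Definition cauchy2 (u : nat -> rat) : Prop :=
  forall e : rat, 0 < e -> exists N, forall m n, (N <= m)%N -> (N <= n)%N ->
    rabs2 (u m - u n) < e.

Definition null2 (u : nat -> rat) : Prop :=
  forall e : rat, 0 < e -> exists N, forall n, (N <= n)%N -> rabs2 (u n) < e.

Lemma null2_cauchy u : null2 u -> cauchy2 u.
Proof.
move=> hu e /hu[N hN]; exists N => m n Nm Nn.
by rewrite (le_lt_trans (rabs2D _ _))// rabs2N gt_max !hN.
Qed.

Lemma null2B u v : null2 u -> null2 v -> null2 (fun n => u n - v n).
Proof.
move=> hu hv e e0; have [N hN] := hu e e0; have [M hM] := hv e e0.
exists (maxn N M) => n; rewrite geq_max => /andP[Nn Mn].
by rewrite (le_lt_trans (rabs2D _ _))// rabs2N gt_max hN ?hM.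
Qed.

Lemma cauchy2B u v : cauchy2 u -> cauchy2 v -> cauchy2 (fun n => u n - v n).
Proof.
move=> hu hv e e0; have [N hN] := hu e e0; have [M hM] := hv e e0.
exists (maxn N M) => m n; rewrite !geq_max => /andP[Nm Mm] /andP[Nn Mn].
have -> : u m - v m - (u n - v n) = (u m - u n) - (v m - v n) by ring.
by rewrite (le_lt_trans (rabs2D _ _))// rabs2N gt_max hN ?hM.
Qed.

Lemma cauchy2_cst (q : rat) : cauchy2 (fun=> q).
Proof. by move=> e e0; exists 0%N => *; rewrite subrr rabs2_0. Qed.

(* a Cauchy sequence is null, or has an eventually constant positive absolute
   value *)
Lemma cauchy2_dich u : cauchy2 u ->
  null2 u \/ exists2 c, 0 < c & exists N, forall n, (N <= n)%N -> rabs2 (u n) = c.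
Proof.
move=> hu; have [|nu] := pselect (null2 u); [by left|right].
have [e [e0 he]] : exists e : rat, 0 < e /\
    forall N, exists2 n, (N <= n)%N & e <= rabs2 (u n).
  apply: contrapT => H; apply: nu => e e0; apply: contrapT => H'.
  apply: H; exists e; split=> // N; apply: contrapT => H''.
  apply: H'; exists N => n Nn; rewrite ltNge; apply/negP => en.
  by apply: H''; exists n.
have [N hN] := hu e e0; have [n0 Nn0 en0] := he N.
exists (rabs2 (u n0)); first exact: lt_le_trans en0.
exists N => n Nn; have lt1 := hN n n0 Nn Nn0.
apply/eqP; rewrite eq_le; apply/andP; split.
  rewrite -[u n](subrK (u n0)) (le_trans (rabs2D _ _))// ge_max lexx andbT.
  by rewrite ltW// (lt_le_trans lt1).
have := rabs2D (u n0 - u n) (u n); rewrite subrK le_max => /orP[|//].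
by rewrite rabs2B leNgt (lt_le_trans lt1).
Qed.

Lemma cauchy2_bound u : cauchy2 u ->
  exists2 C, 0 < C & exists N, forall n, (N <= n)%N -> rabs2 (u n) <= C.
Proof.
move=> /cauchy2_dich[/(_ 1 ltr01)[N hN]|[c c0 [N hN]]].
  by exists 1 => //; exists N => n /hN/ltW.
by exists c => //; exists N => n /hN->.
Qed.

Lemma null2M u v : cauchy2 u -> null2 v -> null2 (fun n => u n * v n).
Proof.
move=> /cauchy2_bound[C C0 [N hN]] hv e e0.
have [M hM] := hv (e / C) (divr_gt0 e0 C0).
exists (maxn N M) => n; rewrite geq_max => /andP[Nn Mn].
rewrite rabs2M; have := hM n Mn; rewrite ltr_pdivlMr// mulrC; apply: le_lt_trans.
by rewrite ler_wpM2r ?rabs2_ge0// hN.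
Qed.

Lemma cauchy2M u v : cauchy2 u -> cauchy2 v -> cauchy2 (fun n => u n * v n).
Proof.
move=> hu hv e e0.
have [C C0 [N hN]] := cauchy2_bound hu; have [D D0 [M hM]] := cauchy2_bound hv.
have [N' hN'] := hu (e / D) (divr_gt0 e0 D0).
have [M' hM'] := hv (e / C) (divr_gt0 e0 C0).
exists (maxn (maxn N M) (maxn N' M')) => m n; rewrite !geq_max.
move=> /andP[/andP[Nm Mm] /andP[N'm M'm]] /andP[/andP[Nn Mn] /andP[N'n M'n]].
have -> : u m * v m - u n * v n = u m * (v m - v n) + (u m - u n) * v n.
  by rewrite mulrBr mulrBl addrA subrK.
rewrite (le_lt_trans (rabs2D _ _))// gt_max !rabs2M; apply/andP; split.
  have := hM' m n M'm M'n; rewrite ltr_pdivlMr// mulrC; apply: le_lt_trans.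
  by rewrite ler_wpM2r ?rabs2_ge0// hN.
have := hN' m n N'm N'n; rewrite ltr_pdivlMr//; apply: le_lt_trans.
by rewrite ler_wpM2l ?rabs2_ge0// hM.
Qed.

Definition cauchy2_pred : {pred nat -> rat} := fun u => `[< cauchy2 u >].

Lemma cauchy2_subring : subring_closed cauchy2_pred.
Proof.
split.
- by apply/asboolP; exact: cauchy2_cst.
- by move=> u v /asboolP hu /asboolP hv; apply/asboolP; exact: cauchy2B.
- by move=> u v /asboolP hu /asboolP hv; apply/asboolP; exact: cauchy2M.
Qed.

HB.instance Definition _ :=
  GRing.isSubringClosed.Build (nat -> rat) cauchy2_pred cauchy2_subring.

Record cseq2 := CSeq2 {
  cseq2_val :> nat -> rat;
  cseq2P : cseq2_val \in cauchy2_pred }.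

HB.instance Definition _ := [isSub for cseq2_val].
HB.instance Definition _ := [Choice of cseq2 by <:].
HB.instance Definition _ := [SubChoice_isSubComNzRing of cseq2 by <:].

Lemma cseq2_cauchy (u : cseq2) : cauchy2 u.
Proof. by apply/asboolP; exact: cseq2P. Qed.

Definition null2_pred : {pred cseq2} := fun u => `[< null2 u >].

Lemma null2_ideal : idealr_closed null2_pred.
Proof.
split.
- by apply/asboolP => e e0; exists 0%N => n _; rewrite /= rabs2_0.
- apply/asboolP => /(_ 1 ltr01)[N /(_ N (leqnn N))].
  by rewrite /= rabs2_1 ltxx.
- move=> a u v /asboolP hu /asboolP hv; apply/asboolP => e e0.
  have [N hN] := null2M (cseq2_cauchy a) hu e0; have [M hM] := hv e e0.
  exists (maxn N M) => n; rewrite geq_max => /andP[Nn Mn].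
  by rewrite (le_lt_trans (rabs2D _ _))// gt_max hM// andbT; exact: hN.
Qed.

HB.instance Definition _ := isIdealr.Build cseq2 null2_pred null2_ideal.

(* Cauchy sequences of rationals for rabs2, modulo null sequences *)
Definition Q2 := {ideal_quot null2_pred}.

HB.instance Definition _ := GRing.ComNzRing.on Q2.

Local Open Scope quotient_scope.

Lemma piQ2_eq (u v : cseq2) :
  (\pi_Q2 u = \pi_Q2 v) <-> null2 (fun n => u n - v n).
Proof.
split=> [/eqP|h].
  by rewrite -[_ == _]Quotient.idealrBE => /asboolP.
by apply/eqP; rewrite -[_ == _]Quotient.idealrBE; apply/asboolP.
Qed.

Lemma piQ2_eq0 (u : cseq2) : (\pi_Q2 u = 0) <-> null2 u.
Proof.
rewrite -(rmorph0 \pi_Q2) piQ2_eq; split=> h e /h[N hN]; exists N => n /hN.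
  by rewrite subr0.
by rewrite /= subr0.
Qed.

Definition inv2 (x : Q2) : Q2 :=
  if x == 0 then 0 else xget 0 [set y | y * x = 1].

Lemma mulVf2 (x : Q2) : x != 0 -> inv2 x * x = 1.
Proof.
move=> x0; rewrite /inv2 (negPf x0).
suff [y yx] : exists y, y * x = 1 by apply: (xgetPex 0 (P := [set y | y * x = 1])); exists y.
elim/quotP: x x0 => u _ /eqP u0.
have [/piQ2_eq0//|[c c0 [N hN]]] := cauchy2_dich (cseq2_cauchy u).
have hv : (fun n => (u n)^-1) \in cauchy2_pred.
  apply/asboolP => e e0.
  have [M hM] := cseq2_cauchy u (mulr_gt0 e0 (mulr_gt0 c0 c0)).
  exists (maxn N M) => m n; rewrite !geq_max => /andP[Nm Mm] /andP[Nn Mn].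
  have um0 : u m != 0 by rewrite -rabs2_gt0 hN.
  have un0 : u n != 0 by rewrite -rabs2_gt0 hN.
  have -> : (u m)^-1 - (u n)^-1 = (u n - u m) / (u m * u n).
    by field; rewrite um0 un0.
  by rewrite !rabs2M rabs2V rabs2M !hN// ltr_pdivrMr ?mulr_gt0// hM.
exists (\pi_Q2 (CSeq2 hv)); rewrite -rmorphM -(rmorph1 \pi_Q2).
apply/piQ2_eq => e e0; exists N => n Nn.
change (rabs2 ((u n)^-1 * u n - 1) < e).
by rewrite mulVf ?subrr ?rabs2_0// -rabs2_gt0 hN.
Qed.

Lemma invr02 : inv2 0 = 0. Proof. by rewrite /inv2 eqxx. Qed.

HB.instance Definition _ := GRing.ComNzRing_isField.Build Q2 mulVf2 invr02.

(* |u_n| is eventually constant unless u is null; when u is null without being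
   eventually zero the set below is empty and xget returns 0 *)
Definition cseq2_abs (u : cseq2) : rat :=
  xget 0 [set c | exists N, forall n, (N <= n)%N -> rabs2 (u n) = c].

Definition abs2 (x : Q2) : rat := cseq2_abs (repr x).

Lemma cseq2_abs_null (u : cseq2) : null2 u -> cseq2_abs u = 0.
Proof.
move=> hu; rewrite /cseq2_abs; case: xgetP => // c _ [N hN].
apply/eqP; rewrite eq_le -{2}(hN N (leqnn _)) rabs2_ge0 andbT leNgt.
apply/negP => /hu[M /(_ (maxn N M) (leq_maxr _ _))].
by rewrite hN ?leq_maxl// ltxx.
Qed.

Lemma cseq2_abs_const (u : cseq2) c N :
  (forall n, (N <= n)%N -> rabs2 (u n) = c) -> cseq2_abs u = c.
Proof.
move=> hc; rewrite /cseq2_abs; case: xgetP => [d _ [M hd]|/(_ c)[]]; last first.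
  by exists N.
by rewrite -(hd (maxn N M)) ?leq_maxr// hc ?leq_maxl.
Qed.

Lemma abs2_pi (u : cseq2) : abs2 (\pi_Q2 u) = cseq2_abs u.
Proof.
rewrite /abs2; set v := repr _.
have uv : null2 (fun n => u n - v n) by apply/piQ2_eq; rewrite /v reprK.
have [hu|[c c0 [N hN]]] := cauchy2_dich (cseq2_cauchy u).
  rewrite !cseq2_abs_null// => e e0; have [N hN] := null2B hu uv e0.
  by exists N => n /hN; rewrite opprB addrCA subrr addr0.
rewrite (cseq2_abs_const hN); have [M hM] := uv c c0.
apply: (@cseq2_abs_const _ _ (maxn N M)) => n; rewrite geq_max => /andP[Nn Mn].
have lt := hM n Mn; apply/eqP; rewrite eq_le; apply/andP; split.
  rewrite -[v n](subKr (u n)) (le_trans (rabs2D _ _))// rabs2N ge_max hN// lexx.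
  by rewrite ltW.
have := rabs2D (u n - v n) (v n); rewrite subrK hN// le_max => /orP[|//].
by rewrite leNgt lt.
Qed.

Lemma abs2_spec (u : cseq2) :
  (\pi_Q2 u = 0 /\ abs2 (\pi_Q2 u) = 0) \/
  (0 < abs2 (\pi_Q2 u) /\
   exists N, forall n, (N <= n)%N -> rabs2 (u n) = abs2 (\pi_Q2 u)).
Proof.
rewrite abs2_pi.
have [hu|[c c0 [N hN]]] := cauchy2_dich (cseq2_cauchy u).
  by left; rewrite cseq2_abs_null//; split=> //; apply/piQ2_eq0.
by right; rewrite (cseq2_abs_const hN); split=> //; exists N.
Qed.

Lemma abs2_0 : abs2 0 = 0.
Proof.
rewrite -(rmorph0 \pi_Q2) abs2_pi cseq2_abs_null// => e e0.
by exists 0%N => n _; rewrite rabs2_0.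
Qed.

Lemma abs2_ge0 x : 0 <= abs2 x.
Proof.
by elim/quotP: x => u _; have [[_ ->]//|[/ltW]] := abs2_spec u.
Qed.

Lemma abs2_eq0 x : (abs2 x == 0) = (x == 0).
Proof.
apply/idP/idP => [|/eqP->]; last by rewrite abs2_0.
elim/quotP: x => u _; have [[-> _]//|[+ _]] := abs2_spec u.
by rewrite lt0r => /andP[/negPf->].
Qed.

Lemma abs2_gt0 x : (0 < abs2 x) = (x != 0).
Proof. by rewrite lt0r abs2_ge0 andbT abs2_eq0. Qed.

Lemma abs2M x y : abs2 (x * y) = abs2 x * abs2 y.
Proof.
have [->|x0] := eqVneq x 0; first by rewrite mul0r abs2_0 mul0r.
have [->|y0] := eqVneq y 0; first by rewrite mulr0 abs2_0 mulr0.
elim/quotP: x x0 => u _ u0; elim/quotP: y y0 => v _ v0.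
have [[/eqP]|[_ [N hN]]] := abs2_spec u; first by rewrite (negPf u0).
have [[/eqP]|[_ [M hM]]] := abs2_spec v; first by rewrite (negPf v0).
rewrite -rmorphM abs2_pi; apply: (@cseq2_abs_const _ _ (maxn N M)) => n.
by rewrite geq_max => /andP[Nn Mn]; rewrite rabs2M hN ?hM.
Qed.

Lemma abs2_1 : abs2 1 = 1.
Proof.
have h : abs2 1 != 0 by rewrite abs2_eq0 oner_eq0.
by apply: (mulfI h); rewrite -abs2M !mulr1.
Qed.

Lemma abs2N x : abs2 (- x) = abs2 x.
Proof.
have : abs2 (- 1) ^+ 2 = 1 by rewrite expr2 -abs2M mulrNN mulr1 abs2_1.
move/eqP; rewrite sqrp_eq1 ?abs2_ge0// => /eqP h.
by rewrite -mulN1r abs2M h mul1r.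
Qed.

Lemma abs2D x y : abs2 (x + y) <= Num.max (abs2 x) (abs2 y).
Proof.
have [->|x0] := eqVneq x 0; first by rewrite add0r le_max lexx orbT.
have [->|y0] := eqVneq y 0; first by rewrite addr0 le_max lexx.
have [->|] := eqVneq (x + y) 0; first by rewrite abs2_0 le_max abs2_ge0.
elim/quotP: x x0 => u _ u0; elim/quotP: y y0 => v _ v0; rewrite -rmorphD => uv0.
have [[/eqP]|[_ [N hN]]] := abs2_spec u; first by rewrite (negPf u0).
have [[/eqP]|[_ [M hM]]] := abs2_spec v; first by rewrite (negPf v0).
have [[/eqP]|[_ [K hK]]] := abs2_spec (u + v); first by rewrite (negPf uv0).
pose n := maxn K (maxn N M); rewrite -(hK n) ?leq_maxl// -(hN n).
  by rewrite -(hM n) ?rabs2D// !leq_max leqnn !orbT.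
by rewrite !leq_max leqnn !orbT.
Qed.

HB.instance Definition _ := isPointed.Build Q2 0.

Fact abs2_dist_xx (x : Q2) : abs2 (x - x) = 0.
Proof. by rewrite subrr abs2_0. Qed.

Fact abs2_dist_positivity (x y : Q2) : abs2 (x - y) = 0 -> x = y.
Proof. by move/eqP; rewrite abs2_eq0 subr_eq0 => /eqP. Qed.

Fact abs2_dist_sym (x y : Q2) : abs2 (x - y) = abs2 (y - x).
Proof. by rewrite -abs2N opprB. Qed.

Fact abs2_dist_triangle (y x z : Q2) :
  abs2 (x - z) <= abs2 (x - y) + abs2 (y - z).
Proof.
rewrite -[x - z](subrKA y) (le_trans (abs2D _ _))// ge_max.
by rewrite lerDl lerDr !abs2_ge0.
Qed.

HB.instance Definition _ := @isMetric.Build rat Q2 (fun x y => abs2 (x - y))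
  abs2_dist_xx abs2_dist_positivity abs2_dist_sym abs2_dist_triangle.

(* abs2_ratr, ratr_dense2 and abs2_complete: (Q2, abs2) is the completion of
   (rat, rabs2) *)

Definition cst2 (q : rat) : cseq2 := CSeq2 (asboolT (cauchy2_cst q)).

Fact cst2_zmod : zmod_morphism cst2. Proof. by move=> p q; apply: val_inj. Qed.
Fact cst2_monoid : monoid_morphism cst2.
Proof. by split=> [|p q]; apply: val_inj. Qed.

HB.instance Definition _ := GRing.isZmodMorphism.Build rat cseq2 cst2 cst2_zmod.
HB.instance Definition _ :=
  GRing.isMonoidMorphism.Build rat cseq2 cst2 cst2_monoid.

Definition rat2 (q : rat) : Q2 := \pi_Q2 (cst2 q).

Fact rat2_zmod : zmod_morphism rat2.
Proof. by move=> p q; rewrite /rat2 !rmorphB. Qed.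
Fact rat2_monoid : monoid_morphism rat2.
Proof. by split=> [|p q]; rewrite /rat2 (rmorph1, rmorphM) (rmorph1, rmorphM). Qed.

HB.instance Definition _ := GRing.isZmodMorphism.Build rat Q2 rat2 rat2_zmod.
HB.instance Definition _ :=
  GRing.isMonoidMorphism.Build rat Q2 rat2 rat2_monoid.

Lemma rat2E (q : rat) : rat2 q = ratr q.
Proof. by rewrite -(fmorph_rat rat2) [ratr q]divq_num_den. Qed.

Lemma abs2_ratr (q : rat) : abs2 (ratr q) = rabs2 q.
Proof. by rewrite -rat2E abs2_pi; apply: (@cseq2_abs_const _ _ 0). Qed.

Lemma ratr_dense2 (x : Q2) (e : rat) : 0 < e ->
  exists q : rat, abs2 (x - ratr q) < e.
Proof.
move=> e0; elim/quotP: x => u _; have [N hN] := cseq2_cauchy u e0.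
exists (u N); rewrite -rat2E -rmorphB.
have [[_ ->]//|[_ [M hM]]] := abs2_spec (u - cst2 (u N)).
by rewrite -(hM (maxn N M)) ?leq_maxr// hN ?leq_maxl.
Qed.

Lemma abs2_complete (x : nat -> Q2) :
  (forall e : rat, 0 < e -> exists N, forall m n, (N <= m)%N -> (N <= n)%N ->
    abs2 (x m - x n) < e) ->
  exists l, forall e : rat, 0 < e -> exists N, forall n, (N <= n)%N ->
    abs2 (x n - l) < e.
Proof.
move=> xc.
have small (e : rat) : 0 < e -> exists N, forall n, (N <= n)%N -> n.+1%:R^-1 < e.
  move=> e0; exists (Num.truncn e^-1) => n Nn.
  rewrite invf_plt ?posrE// (lt_le_trans (truncnS_gt _))// ler_nat ltnS//.
pose q n := xget 0 [set q | abs2 (x n - ratr q) < n.+1%:R^-1].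
have qP n : abs2 (x n - ratr (q n)) < n.+1%:R^-1.
  by apply: (xgetPex 0 (P := [set q | abs2 (x n - ratr q) < n.+1%:R^-1]));
    apply: ratr_dense2; rewrite invr_gt0.
have cq : cauchy2 q.
  move=> e e0; have [N hN] := xc e e0; have [M hM] := small e e0.
  exists (maxn N M) => m n; rewrite !geq_max => /andP[Nm Mm] /andP[Nn Mn].
  rewrite -abs2_ratr -rat2E (rmorphB rat2) /= !rat2E.
  have -> : ratr (q m) - ratr (q n) =
    (x m - x n) + ((x n - ratr (q n)) - (x m - ratr (q m))) :> Q2 by ring.
  rewrite (le_lt_trans (abs2D _ _))// gt_max hN//=.
  rewrite (le_lt_trans (abs2D _ _))// gt_max abs2N.
  by rewrite !(lt_trans (qP _))// hM.
pose u := CSeq2 (asboolT cq); exists (\pi_Q2 u) => e e0.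
have [N hN] := cq e e0; have [M hM] := small e e0.
exists (maxn N M) => n; rewrite geq_max => /andP[Nn Mn].
rewrite -[x n](subrK (ratr (q n))) -addrA (le_lt_trans (abs2D _ _))// gt_max.
rewrite (lt_trans (qP _)) ?hM//= -rat2E -(rmorphB \pi_Q2).
have [[_ ->]//|[_ [K hK]]] := abs2_spec (cst2 (q n) - u).
by rewrite -(hK (maxn N K)) ?leq_maxr// hN ?leq_maxl.
Qed.

Local Close Scope quotient_scope.

Record abs2_extension (R : realType) (L : fieldExtType Q2) (v : L -> R) : Prop :=
  Abs2Extension {
    abs2_ext_ge0 : forall x, 0 <= v x;
    abs2_ext_eq0 : forall x, v x = 0 -> x = 0;
    abs2_extM : forall x y, v (x * y) = v x * v y;
    abs2_extD : forall x y, v (x + y) <= v x + v y;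
    abs2_extE : forall x : Q2, v x%:A = ratr (abs2 x) }.

(* None is the point at infinity *)

Notation P1 := (one_point_compactification Q2).

(* if c = 0 and d != 0 this is the affine map, fixing infinity *)
Definition homography (a b c d : Q2) (z : P1) : P1 :=
  if z is Some x then
    if c * x + d == 0 then None else Some ((a * x + b) / (c * x + d))
  else if c == 0 then None else Some (a / c).

Definition affine (eta t : Q2) (z : P1) : P1 :=
  if z is Some x then Some (eta * x + t) else None.

Definition inversion (z : P1) : P1 :=
  if z is Some x then if x == 0 then None else Some x^-1 else Some 0.

Definition subsystem (T : topologicalType) (phi : T -> T) (B : set T) : Prop :=
  [/\ B !=set0, compact B & phi @` B `<=` B].

Definition minimal_subsystem (T : topologicalType) (phi : T -> T) (B : set T) :
    Prop :=
  subsystem phi B /\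
  forall x, B x -> B = closure (range (fun n => iter n phi x)).

Notation borel T := (g_sigma_algebraType (@open T)).

(* a Borel probability measure on B is encoded as a Borel probability measure
   on the whole space that gives mass 1 to B *)
Definition invariant_probability (R : realType) (T : ptopologicalType)
    (phi : T -> T) (B : set T) (sigma : probability (borel T) R) : Prop :=
  sigma B = 1%E /\
  forall A : set (borel T), measurable A -> A `<=` B ->
    sigma (B `&` phi @^-1` A) = sigma A.

Definition Z2 : set Q2 := [set x | abs2 x <= 1].

(* the Haar probability of Z_2, seen as a Borel measure on Q2 carried by Z_2 *)
Definition haar_Z2 (R : realType) (mu0 : probability (borel Q2) R) : Prop :=
  mu0 Z2 = 1%E /\
  forall (x : Q2) (A : set (borel Q2)), Z2 x -> measurable A -> A `<=` Z2 ->
    mu0 [set x + y | y in A] = mu0 A.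

Definition mu_bar (R : realType) (mu0 : set Q2 -> \bar R) (S : set P1) : \bar R :=
  let ZP : set P1 := Some @` Z2 in
  let S1 := ZP `&` S in
  let S2 := ~` ZP `&` S in
  ((2^-1)%:E * mu0 (Some @^-1` S1) + mu0 (Some @^-1` (inversion @^-1` S2)))%E.

(* Main.v *)
Require Import Defs.
From HB Require Import structures.
From mathcomp Require Import all_boot all_order all_algebra all_field.
From mathcomp Require Import all_classical all_reals all_analysis.
From mathcomp Require Import ring lra.

(* After conjugation by h the map becomes x |-> (al x + D be) / (be x + al) with
   |D| = 2, that is, multiplication by al + be sqrt D on the projective line of
   the ramified plane Q2(sqrt D). It preserves the norm p^2 - D q^2 up to a
   factor, hence the chordal distance |det(u, u')|^2 / (|N u| |N u'|), whose balls
   are the cells: balls of Z_2 and images under inversion of balls of 2 Z_2. Cells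
   of the same level have the same mu_bar mass, so mu_bar is invariant. On a
   minimal set the map permutes the cells of each level transitively, so every
   invariant probability gives them equal masses and is determined by the pi-system
   of cells. Finally B contains a cell, so that mu_bar (h^-1 B) > 0. *)

Set Implicit Arguments.
Unset Strict Implicit.
Unset Printing Implicit Defensive.

Import Order.TTheory GRing.Theory Num.Theory.

Local Open Scope classical_set_scope.
Local Open Scope ring_scope.

(** The size of [eta] is what produces |D| = 2: here D = Delta / (4 c^2 eta^2), with |eta|^2 = 2
    |Delta| / |c|^2 and |4| = 1/4. As 2 is not the square of a value, |p|^2 and 2 |q|^2 differ
    unless p = q = 0, so |p^2 - D q^2| is their maximum. Which of the two is larger tells whether p
    / q lies in Z_2; these two cases are the cells of level 0, and the weight 1/2 in [mu_bar] gives
    each of them mass 1/2. The main obstacle is the positive mass of B, since a closed orbit could a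
    priori be null. Squaring al + be sqrt D and dividing by the rational part gives 1 + y sqrt D
    with |y| <= 1/2 and y nonzero, because neither the trace nor c vanishes. Each further squaring
    replaces y by 2 y / (1 + D y^2) and so halves |y|. Since 1 + y sqrt D moves every point by the
    same distance |y|, an orbit can be steered down the binary tree below a cell of some fixed
    level, and its closure contains that cell. The tree is binary because the residue field has two
    elements. *)

(** * Value group and residue field of the 2-adic absolute value *)

Lemma rabs2_pow (q : rat) : q != 0 -> exists n : int, rabs2 q = 2 ^ n.
Proof.
move=> q0; exists ((logn 2 `|denq q|)%:Z - (logn 2 `|numq q|)%:Z).
by rewrite /rabs2 (negPf q0) expfzDr// exprnN.
Qed.

Lemma rabs2_int (n : int) : rabs2 n%:~R <= 1.
Proof.
have [->|n0] := eqVneq n 0; first by rewrite rabs2_0.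
rewrite -[n%:~R]divr1 (rabs2_frac n0 (d := 1))// expr0 mul1r.
by rewrite invf_le1 ?exprn_gt0// exprn_ege1.
Qed.

Lemma rabs2_2 : rabs2 2 = 2^-1. Proof. by []. Qed.

Lemma rabs2_even (n : int) : (2 %| n)%Z -> rabs2 n%:~R <= 2^-1.
Proof.
move=> /dvdzP[k ->]; rewrite intrM rabs2M rabs2_2 ler_piMl//.
exact: rabs2_int.
Qed.

Lemma rabs2_odd (n : int) : ~~ (2 %| n)%Z -> rabs2 n%:~R = 1.
Proof.
move=> n2; have n0 : n != 0 by apply: contraNneq n2 => ->; rewrite dvdz0.
rewrite -[n%:~R]divr1 (rabs2_frac n0 (d := 1))//.
by rewrite (@lognE 2 `|n|) [(2 %| `|n|)%N](negPf n2) !andbF.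
Qed.

(* The residue field of rat at 2 has two elements. *)
Lemma rabs2_unitB1 (q : rat) : rabs2 q = 1 -> rabs2 (q - 1) <= 2^-1.
Proof.
move=> q1.
have d0 : rabs2 (denq q)%:~R != 0 by rewrite rabs2_eq0 intr_eq0 denq_eq0.
have e : rabs2 (numq q)%:~R = rabs2 (denq q)%:~R.
  by rewrite -[LHS](mulfVK d0) -rabs2V -rabs2M divq_num_den q1 mul1r.
have nd : ~~ (2 %| denq q)%Z.
  apply/negP => hd; have hn : (2 %| numq q)%Z.
    by apply: contraT => /rabs2_odd; rewrite e => h; have := rabs2_even hd; rewrite h.
  have := dvdn_gcd 2 `|numq q| `|denq q|.
  by rewrite (eqP (coprime_num_den q)) [X in X && _]hn [X in _ && X]hd.
have nn : ~~ (2 %| numq q)%Z.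
  by apply/negP => /rabs2_even; rewrite e rabs2_odd.
have -> : q - 1 = (numq q - denq q)%:~R / (denq q)%:~R.
  by rewrite intrB mulrBl divff ?intr_eq0 ?denq_eq0// divq_num_den.
rewrite rabs2M rabs2V (rabs2_odd nd) invr1 mulr1 rabs2_even//.
move: nn nd; rewrite !dvdzE /= => nn nd.
have mod1 (n : int) : ~~ (2 %| `|n|)%N -> exists k, n = k * 2 + 1.
  move=> h; exists (n %/ 2)%Z; rewrite {1}(divz_eq n 2); congr (_ + _).
  have : (n %% 2)%Z != 0.
    apply: contra h => /eqP h; rewrite -[(2 %| _)%N]/(2 %| n)%Z.
    exact/dvdz_mod0P.
  have := @modz_ge0 n 2 isT; have := @ltz_pmod n 2 isT.
  by case: (n %% 2)%Z => // [[|[]]].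
have [k ->] := mod1 _ nn; have [l ->] := mod1 _ nd.
have -> : k * 2 + 1 - (l * 2 + 1) = (k - l) * 2 by ring.
by rewrite abszM dvdn_mull.
Qed.

Lemma abs2V (x : Q2) : abs2 x^-1 = (abs2 x)^-1.
Proof.
have [->|x0] := eqVneq x 0; first by rewrite ?(invr0, abs2_0).
have h : abs2 x != 0 by rewrite abs2_eq0.
by apply: (mulfI h); rewrite -abs2M !divff// abs2_1.
Qed.

Lemma abs2X (x : Q2) n : abs2 (x ^+ n) = abs2 x ^+ n.
Proof. by elim: n => [|n ih]; rewrite ?expr0 ?abs2_1// !exprS abs2M ih. Qed.

Lemma abs2B (x y : Q2) : abs2 (x - y) = abs2 (y - x).
Proof. by rewrite -abs2N opprB. Qed.

Lemma abs2D_le (x y : Q2) r : abs2 x <= r -> abs2 y <= r -> abs2 (x + y) <= r.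
Proof. by move=> hx hy; rewrite (le_trans (abs2D _ _))// ge_max hx. Qed.

Lemma abs2D_eq (x y : Q2) : abs2 y < abs2 x -> abs2 (x + y) = abs2 x.
Proof.
move=> yx; apply/eqP; rewrite eq_le abs2D_le ?(ltW yx)//=.
rewrite -[leLHS]/(abs2 x) -{1}[x](addrK y) leNgt; apply/negP => h.
suff : abs2 (x + y - y) < abs2 x by rewrite addrK ltxx.
by rewrite (le_lt_trans (abs2D _ _))// abs2N gt_max yx andbT -{2}[x](addrK y).
Qed.

(** Transfers facts about values from [rat] to [Q2]: an error smaller than [x] does not change the
    absolute value. *)
Lemma abs2_rat (x : Q2) e : 0 < e -> exists2 q : rat, abs2 (x - ratr q) < e &
  (e <= abs2 x -> abs2 x = rabs2 q).
Proof.
move=> e0; have [q hq] := ratr_dense2 x e0; exists q => // ex.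
rewrite -abs2_ratr -[in RHS](subKr x (ratr q)) abs2D_eq//.
by rewrite abs2N (lt_le_trans hq).
Qed.

Lemma abs2_2 : abs2 2 = 2^-1.
Proof. by rewrite -(ratr_nat Q2 2) abs2_ratr rabs2_2. Qed.

Lemma abs2_pow (x : Q2) : x != 0 -> exists n : int, abs2 x = 2 ^ n.
Proof.
move=> x0; have h : 0 < abs2 x by rewrite abs2_gt0.
have [q _ /(_ (lexx _)) e] := abs2_rat x h; rewrite e.
by apply: rabs2_pow; rewrite -rabs2_eq0 -e abs2_eq0.
Qed.

(** Nonzero values are integral powers of 2, so a strict inequality gains a factor 2. *)
Lemma abs2_lt_half (x y : Q2) : abs2 x < abs2 y -> abs2 x <= abs2 y / 2.
Proof.
have [->|x0] := eqVneq x 0; first by rewrite abs2_0 => /ltW y0; rewrite divr_ge0.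
have [->|y0] := eqVneq y 0; first by rewrite abs2_0 ltNge abs2_ge0.
have [n ->] := abs2_pow x0; have [m ->] := abs2_pow y0.
rewrite ltr_eXz2l// -exprN1 => nm.
by rewrite -expfzDr// ler_eXz2l// -ltzD1 subrK.
Qed.

Lemma abs2_lt1 (x : Q2) : (abs2 x < 1) = (abs2 x <= 2^-1).
Proof.
apply/idP/idP => [|/le_lt_trans]; last exact.
by rewrite -abs2_1 => /abs2_lt_half; rewrite abs2_1 mul1r.
Qed.

(** The quotient [x / y] is a unit, hence congruent to 1 modulo 2; a rational approximation within
    1/2 reduces this to [rabs2_unitB1]. *)
Lemma abs2_eq_half (x y : Q2) : abs2 x = abs2 y -> abs2 (x - y) <= abs2 y / 2.
Proof.
move=> xy; have [y0|y0] := eqVneq y 0.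
  by move: xy; rewrite y0 abs2_0 => /eqP; rewrite abs2_eq0 => /eqP->; rewrite subr0 abs2_0 mul0r.
have ay0 : abs2 y != 0 by rewrite abs2_eq0.
have xy1 : abs2 (x / y) = 1 by rewrite abs2M abs2V xy divff.
have -> : x - y = (x / y - 1) * y by rewrite mulrBl mul1r divfK.
rewrite abs2M mulrC ler_wpM2l ?abs2_ge0//.
have [|q hq /(_ _) h] := @abs2_rat (x / y) 2^-1; first by [].
rewrite -(subrKA (ratr q)) abs2D_le ?(ltW hq)//.
have -> : ratr q - 1 = ratr (q - 1) :> Q2 by rewrite -!rat2E rmorphB rmorph1.
rewrite abs2_ratr rabs2_unitB1//.
by rewrite -h xy1.
Qed.

Lemma abs2_dist_eq_half (x y z : Q2) : abs2 (x - y) = abs2 (z - y) ->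
  abs2 (x - z) <= abs2 (x - y) / 2.
Proof. 
move=> h; have -> : x - z = (x - y) - (z - y) by ring.
by rewrite [in leRHS]h abs2_eq_half. Qed.

(** * Homogeneous coordinates on the projective line *)

Section Projective.
Variable F : fieldType.

(** Homogeneous coordinates, as a relation: a homography then acts linearly on them, with no case
    distinction at its pole or at infinity. *)
Definition represents (p q : F) (z : option F) : Prop :=
  if z is Some x then q != 0 /\ p = q * x else p != 0 /\ q = 0.

Lemma represents_ex z : exists p q, represents p q z.
Proof.
case: z => [x|]; first by exists x, 1; rewrite /= oner_eq0 mul1r.
by exists 1, 0; rewrite /= oner_eq0.
Qed.

Lemma represents_inj p q z z' : represents p q z -> represents p q z' -> z = z'.
Proof.
case: z z' => [x|] [x'|] //= [h1 e1] [h2 e2].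
- by congr Some; apply: (mulfI h1); rewrite -e1.
- by move: h1; rewrite e2 eqxx.
- by move: h2; rewrite e1 eqxx.
Qed.

Lemma represents_neq0 p q z : represents p q z -> (p != 0) || (q != 0).
Proof. by case: z => [x|] /= [-> _]//; rewrite orbT. Qed.

Lemma represents_total p q : (p != 0) || (q != 0) -> exists z, represents p q z.
Proof.
have [->|q0 _] := eqVneq q 0; first by rewrite orbF => p0; exists None.
by exists (Some (p / q)); split=> //; rewrite mulrC divfK.
Qed.

Lemma representsZ s p q z : s != 0 ->
  represents (s * p) (s * q) z <-> represents p q z.
Proof.
move=> s0; case: z => [x|] /=; rewrite mulf_eq0 negb_or s0 /=; split=> -[h e]; split=> //.
- by apply: (mulfI s0); rewrite mulrA.
- by rewrite e mulrA.
- by apply/eqP; move/eqP: e; rewrite mulf_eq0 (negPf s0).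
- by rewrite e mulr0.
Qed.

End Projective.

Lemma represents_homography (a b c d : Q2) p q (z : P1) : a * d - b * c != 0 ->
  represents p q z ->
  represents (a * p + b * q) (c * p + d * q) (homography a b c d z).
Proof.
move=> had; case: z => [x|] /= [h e]; rewrite e.
  have -> : a * (q * x) + b * q = q * (a * x + b) by ring.
  have -> : c * (q * x) + d * q = q * (c * x + d) by ring.
  case: eqVneq => [e0|ne0] /=; last first.
    by rewrite mulf_neq0// -mulrA [X in _ = q * X]mulrC divfK.
  rewrite e0 mulr0; split=> //; apply: mulf_neq0 => //.
  apply: contra_neq had => e1.
  (* Numerator and denominator cannot vanish together: for nonzero [c], they generate [c] times the
     determinant. *)
  have [c0|c0] := eqVneq c 0.
    by move: e0; rewrite c0 mul0r add0r mulr0 subr0 => ->; rewrite mulr0.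
  apply: (mulfI c0); rewrite mulr0.
  have -> : c * (a * d - b * c) = a * c * (c * x + d) - c * c * (a * x + b) by ring.
  by rewrite e0 e1 !mulr0 subrr.
rewrite !mulr0 !addr0; case: eqVneq => [c0|c0] /=.
  rewrite c0 mul0r mulf_neq0//; apply: contra_neq had => ->.
  by rewrite c0 mulr0 mul0r subrr.
by rewrite mulf_neq0//; split=> //; rewrite mulrAC (mulrC c) divfK.
Qed.

Lemma represents_affine (eta t : Q2) p q (z : P1) : eta != 0 ->
  represents p q z -> represents (eta * p + t * q) q (affine eta t z).
Proof.
move=> e0; case: z => [x|] /= [h e]; rewrite e; first by split=> //; ring.
by rewrite mulr0 addr0 mulf_neq0.
Qed.

Lemma affineK (eta t : Q2) : eta != 0 ->
  cancel (affine eta t) (affine eta^-1 (- t / eta)).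
Proof.
move=> e0 [x|]//=; congr Some.
by rewrite mulrDr mulKf// mulNr [_^-1 * t]mulrC addrK.
Qed.

Lemma affineVK (eta t : Q2) : eta != 0 ->
  cancel (affine eta^-1 (- t / eta)) (affine eta t).
Proof.
move=> e0 [x|]//=; congr Some.
by rewrite mulrDr mulVKf// mulrCA divff// mulr1 subrK.
Qed.

(** * Cells of the projective line *)

Definition integral (z : P1) : bool := if z is Some x then abs2 x <= 1 else false.

(* The factor 2 makes the distance of the charts equal to the chordal distance
   attached to the norm p^2 - D q^2 with |D| = 2 (see chordal_cell). *)
Definition chart (z : P1) : Q2 :=
  if z is Some x then if abs2 x <= 1 then 2 * x else x^-1 else 0.

(** Charts have absolute value at most 1/2, so the exponent [m.+1] makes level 0 the partition into
    [Z2] and its complement. *)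
Definition same_cell (m : nat) (z z' : P1) : Prop :=
  integral z = integral z' /\ abs2 (chart z - chart z') <= 2 ^- m.+1.

Definition cell (m : nat) (z : P1) : set P1 := [set z' | same_cell m z z'].

Lemma same_cell_refl m z : same_cell m z z.
Proof. by split=> //; rewrite subrr abs2_0 invr_ge0 exprn_ge0. Qed.

Lemma same_cell_sym m z z' : same_cell m z z' -> same_cell m z' z.
Proof. by move=> [e h]; split=> //; rewrite abs2B. Qed.

Lemma same_cell_trans m z1 z2 z3 :
  same_cell m z1 z2 -> same_cell m z2 z3 -> same_cell m z1 z3.
Proof.
move=> [e h] [e' h']; split; first by rewrite e.
by rewrite -(subrKA (chart z2)) abs2D_le.
Qed.

Lemma same_cell_le m n z z' : (m <= n)%N -> same_cell n z z' -> same_cell m z z'.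
Proof.
move=> mn [e h]; split=> //; rewrite (le_trans h)//.
by rewrite lef_pV2 ?posrE ?exprn_gt0// ler_eXn2l.
Qed.

Lemma abs2_chart z : abs2 (chart z) <= 2^-1.
Proof.
case: z => [x|] /=; last by rewrite abs2_0.
case: ifP => [h|/negbT]; first by rewrite abs2M abs2_2 ler_piMr.
rewrite -ltNge => h; rewrite -abs2_lt1 abs2V invf_lt1//.
exact: lt_trans h.
Qed.

(* Each cell consists of two cells of the next level. *)
Lemma same_cell_split m z z1 z2 : same_cell m z z1 -> same_cell m z z2 ->
  ~ same_cell m.+1 z z1 -> ~ same_cell m.+1 z z2 -> same_cell m.+1 z1 z2.
Proof.
move=> [h1 e1] [h2 e2] n1 n2; split; first by rewrite -h1.
have pow (x : Q2) : abs2 x <= 2 ^- m.+1 -> ~ abs2 x <= 2 ^- m.+2 ->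
    abs2 x = 2 ^- m.+1.
  move=> hx nx; apply/eqP; rewrite eq_le hx /= leNgt; apply/negP => lt; apply: nx.
  have e : abs2 (2 ^+ m.+1) = 2 ^- m.+1 by rewrite abs2X abs2_2 exprVn.
  by rewrite exprSr invfM -e abs2_lt_half// e.
have {}n1 := pow _ e1 (fun h => n1 (conj h1 h)).
have {}n2 := pow _ e2 (fun h => n2 (conj h2 h)).
rewrite (exprSr _ m.+1) invfM -n1 (abs2B (chart z)).
by apply: abs2_dist_eq_half; rewrite !(abs2B _ (chart z)) n1.
Qed.

(** * The ramified norm and its chordal distance *)

Section RamifiedNorm.
Variables (D : Q2) (D2 : abs2 D = 2).

(* |p^2 - D q^2| for |D| = 2: the two terms never have the same absolute
   value, since the extension Q2(sqrt D) is ramified. *)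
Definition qnorm (p q : Q2) : rat := Num.max (abs2 p ^+ 2) (2 * abs2 q ^+ 2).

Lemma abs2_qnorm p q : abs2 (p ^+ 2 - D * q ^+ 2) = qnorm p q.
Proof.
have e : abs2 (- (D * q ^+ 2)) = 2 * abs2 q ^+ 2 by rewrite abs2N abs2M D2 abs2X.
rewrite /qnorm; have [lt|le] := ltP (abs2 q) (abs2 p).
  have h := abs2_lt_half lt; have q0 := abs2_ge0 q.
  have lt2 : 2 * abs2 q ^+ 2 < abs2 p ^+ 2 by nra.
  by rewrite abs2D_eq ?e ?abs2X// max_l// ltW.
have [->|p0] := eqVneq p 0.
  rewrite expr0n sub0r abs2N abs2M D2 abs2X abs2_0 expr0n max_r//.
  by rewrite mulr_ge0// exprn_ge0// abs2_ge0.
have {}p0 : 0 < abs2 p by rewrite abs2_gt0.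
have lt2 : abs2 p ^+ 2 < 2 * abs2 q ^+ 2 by nra.
by rewrite addrC abs2D_eq ?e ?abs2X// max_r// ltW.
Qed.

Lemma qnormZ s p q : qnorm (s * p) (s * q) = abs2 s ^+ 2 * qnorm p q.
Proof.
rewrite -!abs2_qnorm -abs2X -abs2M; congr abs2; ring.
Qed.

Lemma qnormM p q p' q' :
  qnorm (p * p' + D * q * q') (p * q' + q * p') = qnorm p q * qnorm p' q'.
Proof. rewrite -!abs2_qnorm -abs2M; congr abs2; ring. Qed.

Lemma qnorm_gt0 p q : (p != 0) || (q != 0) -> 0 < qnorm p q.
Proof.
rewrite /qnorm lt_max -!abs2_gt0 => /orP[] h; apply/orP; [left|right].
  exact: exprn_gt0.
by apply: mulr_gt0 => //; exact: exprn_gt0.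
Qed.

Lemma mulf_simplify (K : fieldType) (u v w x y : K) : u != 0 -> v != 0 ->
  (u * v * w) / (u * x * (v * y)) = w / (x * y).
Proof.
by move=> u0 v0; rewrite [X in _ / X]mulrACA -mulf_div divff ?mulf_neq0// mul1r.
Qed.

Definition chordal (p q p' q' : Q2) : rat :=
  abs2 (p * q' - p' * q) ^+ 2 / (qnorm p q * qnorm p' q').

Lemma chordal_represents p q p' q' p1 q1 p1' q1' z z' :
  represents p q z -> represents p1 q1 z ->
  represents p' q' z' -> represents p1' q1' z' ->
  chordal p q p' q' = chordal p1 q1 p1' q1'.
Proof.
have rep (x y x' y' : Q2) (w : P1) : represents x y w -> represents x' y' w ->
    exists2 s, s != 0 & x' = s * x /\ y' = s * y.
  case: w => [w|] /= [h e] [h' e'].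
    by exists (y' / y); rewrite ?mulf_neq0 ?invr_eq0// e e' !mulrA !divfK.
  by exists (x' / x); rewrite ?mulf_neq0 ?invr_eq0// e e' mulr0 divfK.
move=> h h1 h' h1'; have [s s0 [-> ->]] := rep _ _ _ _ _ h h1.
have [s' s'0 [-> ->]] := rep _ _ _ _ _ h' h1'.
rewrite /chordal !qnormZ.
have -> : s * p * (s' * q') - s' * p' * (s * q) = (s * s') * (p * q' - p' * q).
  by ring.
have as0 : abs2 s ^+ 2 != 0 by rewrite expf_neq0// abs2_eq0.
have as'0 : abs2 s' ^+ 2 != 0 by rewrite expf_neq0// abs2_eq0.
rewrite !abs2M !exprMn.
by rewrite mulf_simplify.
Qed.

(** The coordinates [(x, 1)] on [Z2] and [(1, x^-1)] outside have [qnorm] 2 and 1. On one side of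
    [Z2], [chordal] is therefore the squared distance of the charts; across, the determinant is a
    unit and [chordal] equals 1/2, above the largest threshold 1/4. *)
Lemma chordal_cell m p q p' q' z z' : represents p q z -> represents p' q' z' ->
  same_cell m z z' <-> chordal p q p' q' <= (2 ^- m.+1) ^+ 2.
Proof.
have outer x : (abs2 x <= 1) = false -> abs2 x^-1 <= 2^-1 /\ x != 0.
  move/negbT; rewrite -ltNge => h; split.
    by rewrite -abs2_lt1 abs2V invf_lt1// (lt_trans _ h).
  by rewrite -abs2_gt0 (lt_trans _ h).
have inner_rep x : represents x 1 (Some x : P1) by rewrite /= oner_neq0 mul1r.
have outer_rep x : (abs2 x <= 1) = false -> represents 1 x^-1 (Some x : P1).
  by move=> /outer[_ x0]; rewrite /= invr_eq0 x0 mulVf.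
have inner_norm x : abs2 x <= 1 -> qnorm x 1 = 2.
  move=> h; rewrite /qnorm abs2_1 expr1n mulr1 max_r//.
  by rewrite (@le_trans _ _ 1)// exprn_ile1// abs2_ge0.
have outer_norm y : abs2 y <= 2^-1 -> qnorm 1 y = 1.
  move=> h; have y0 := abs2_ge0 y.
  rewrite /qnorm abs2_1 expr1n max_l//; nra.
have rep w : exists p1 q1, [/\ represents p1 q1 w,
    (if integral w then q1 = 1 /\ chart w = 2 * p1 else p1 = 1 /\ chart w = q1) &
    qnorm p1 q1 = if integral w then 2 else 1].
  case: w => [x|] /=; last first.
    exists 1, 0; split; rewrite ?oner_eq0//.
    by apply: outer_norm; rewrite abs2_0.
  case: ifPn => [h|/negPf h].
    by exists x, 1; split; [exact: inner_rep|split|exact: inner_norm].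
  exists 1, x^-1; split; [exact: outer_rep|split=> //|].
  by apply: outer_norm; have [] := outer _ h.
move=> hz hz'.
have [p1 [q1 [r1 c1 n1]]] := rep z; have [p2 [q2 [r2 c2 n2]]] := rep z'.
rewrite (chordal_represents hz r1 hz' r2) /chordal n1 n2 /same_cell.
have cz := abs2_chart z; have cz' := abs2_chart z'.
have sq (x y : rat) : 0 <= x -> 0 <= y -> (x ^+ 2 <= y ^+ 2) = (x <= y).
  by move=> x0 y0; rewrite ler_sqr.
have e0 : (0 : rat) <= 2 ^- m.+1 by rewrite invr_ge0 exprn_ge0.
have e1 : (2 ^- m.+1 : rat) <= 2^-1.
  by rewrite exprS invfM ler_piMr// invf_le1 ?exprn_gt0// exprn_ege1.
case: ifP c1 n1 => i1; case: ifP c2 n2 => i2; rewrite ?i1 ?i2.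
- move=> [-> e2] _ [-> e1'] _; rewrite e1' e2 !mulr1 -mulrBr abs2M abs2_2.
  have -> : abs2 (p1 - p2) ^+ 2 / (2 * 2) = (2^-1 * abs2 (p1 - p2)) ^+ 2 by field.
  by rewrite sq ?mulr_ge0 ?abs2_ge0//; split=> [[]|].
- move=> [e3 e2] _ [e4 e1'] _; split=> [[]//|].
  have lt : abs2 (p1 * q2) < 1.
    move: cz cz'; rewrite e1' e2 !abs2M abs2_2; have := abs2_ge0 q2; have := abs2_ge0 p1; nra.
  have -> : abs2 (p1 * q2 - p2 * q1) = 1.
    by rewrite e3 e4 mulr1 abs2B abs2D_eq ?abs2N abs2_1.
  by rewrite mulr1 expr1n => h; exfalso; nra.
- move=> [e3 e2] _ [e4 e1'] _; split=> [[]//|].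
  have lt : abs2 (p2 * q1) < 1.
    move: cz cz'; rewrite e1' e2 !abs2M abs2_2; have := abs2_ge0 q1; have := abs2_ge0 p2; nra.
  have -> : abs2 (p1 * q2 - p2 * q1) = 1.
    by rewrite e3 e4 mulr1 abs2D_eq ?abs2N abs2_1.
  by rewrite mul1r expr1n => h; exfalso; nra.
- move=> [-> e2] _ [-> e1'] _; rewrite e1' e2 !mul1r divr1 sq ?abs2_ge0//.
  by rewrite abs2B; split=> [[]|].
Qed.

End RamifiedNorm.

(** * Multiplications of the ramified plane acting on the line *)

Section Acts.
Variables (D : Q2) (D2 : abs2 D = 2).

(* g is multiplication by al + be * sqrt D on the projective line of the
   plane Q2(sqrt D) *)
Definition acts (al be : Q2) (g : P1 -> P1) : Prop :=
  forall z p q, represents p q z ->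
    represents (al * p + D * be * q) (be * p + al * q) (g z).

Lemma acts_comp (al be al' be' : Q2) f g : acts al be f -> acts al' be' g ->
  acts (al * al' + D * be * be') (al' * be + al * be') (g \o f).
Proof.
move=> hf hg z p q r; have := hg _ _ _ (hf _ _ _ r).
by congr represents; ring.
Qed.

Lemma actsZ (s al be : Q2) g : s != 0 -> acts (s * al) (s * be) g -> acts al be g.
Proof.
move=> s0 h z p q /h r; apply/(representsZ _ _ _ s0).
by move: r; congr represents; ring.
Qed.

Lemma acts_cell (al be : Q2) g m z z' : (al != 0) || (be != 0) -> acts al be g ->
  same_cell m (g z) (g z') <-> same_cell m z z'.
Proof.
move=> ab0 hg; have [p [q r]] := represents_ex z.
have [p' [q' r']] := represents_ex z'.
rewrite (chordal_cell D2 _ r r') (chordal_cell D2 _ (hg _ _ _ r) (hg _ _ _ r')).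
suff -> : chordal (al * p + D * be * q) (be * p + al * q)
   (al * p' + D * be * q') (be * p' + al * q') = chordal p q p' q' by [].
rewrite /chordal !(addrC (be * _)) !(qnormM D2).
have -> : (al * p + D * be * q) * (al * q' + be * p') -
    (al * p' + D * be * q') * (al * q + be * p) =
    (al ^+ 2 - D * be ^+ 2) * (p * q' - p' * q) by ring.
rewrite abs2M (abs2_qnorm D2) exprMn expr2 mulf_simplify//.
  by rewrite gt_eqF// qnorm_gt0.
by rewrite gt_eqF// qnorm_gt0.
Qed.

(** A preimage comes from multiplication by the conjugate [al - be sqrt D]: the product of the two
    is the norm, a nonzero scalar. *)
Lemma acts_surj (al be : Q2) g : (al != 0) || (be != 0) -> acts al be g ->
  forall z', exists z, g z = z'.
Proof.
move=> ab0 hg z'.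
have N0 : al ^+ 2 - D * be ^+ 2 != 0.
  by rewrite -abs2_eq0 (abs2_qnorm D2) gt_eqF// qnorm_gt0.
have [p [q r]] := represents_ex z'.
have h : (al * p - D * be * q != 0) || (al * q - be * p != 0).
  rewrite -negb_and; apply/negP => /andP[/eqP e1 /eqP e2].
  have := represents_neq0 r; rewrite -negb_and => /negP; apply; apply/andP; split.
    rewrite -(inj_eq (mulfI N0)) mulr0.
    have -> : (al ^+ 2 - D * be ^+ 2) * p =
      al * (al * p - D * be * q) + D * be * (al * q - be * p) by ring.
    by rewrite e1 e2 !mulr0 addr0.
  rewrite -(inj_eq (mulfI N0)) mulr0.
  have -> : (al ^+ 2 - D * be ^+ 2) * q =
    be * (al * p - D * be * q) + al * (al * q - be * p) by ring.
  by rewrite e1 e2 !mulr0 addr0.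
have [z rz] := represents_total h; exists z.
apply: represents_inj r; apply/(representsZ _ _ _ N0).
by move: (hg _ _ _ rz); congr represents; ring.
Qed.

(* The chordal distance from z to (1 + y sqrt D) z is |y|, whatever z. *)
Lemma acts_displacement y g z m : abs2 y <= 2^-1 -> acts 1 y g ->
  same_cell m z (g z) <-> abs2 y <= 2 ^- m.+1.
Proof.
move=> hy hg; have [p [q r]] := represents_ex z.
rewrite (chordal_cell D2 _ r (hg _ _ _ r)) /chordal !mul1r.
have -> : p + D * y * q = 1 * p + D * y * q by rewrite mul1r.
rewrite [y * p + q]addrC -[q + y * p](congr1 (+%R^~ (y * p)) (mul1r q)).
rewrite (qnormM D2).
have -> : qnorm 1 y = 1.
  rewrite /qnorm abs2_1 expr1n max_l//; have := abs2_ge0 y; nra.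
have -> : p * (1 * q + y * p) - (1 * p + D * y * q) * q = y * (p ^+ 2 - D * q ^+ 2).
  by ring.
have n0 : qnorm p q != 0 by rewrite gt_eqF// qnorm_gt0// (represents_neq0 r).
rewrite abs2M (abs2_qnorm D2) mul1r exprMn mulfK ?expr2 ?mulf_neq0//.
have e0 : (0 : rat) <= 2 ^- m.+1 by rewrite invr_ge0 exprn_ge0.
by rewrite -!expr2 ler_sqr// nnegrE ?abs2_ge0.
Qed.

(** The square of [al + be sqrt D] is [(al^2 + D be^2) + 2 al be sqrt D]. Scalars act trivially, so
    it may be divided by its rational part. *)
Lemma acts_square (al be : Q2) g : al != 0 -> be != 0 -> acts al be g ->
  exists2 y, abs2 y = abs2 al * abs2 be / (2 * qnorm al be) & acts 1 y (g \o g).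
Proof.
move=> al0 be0 hg.
have e : abs2 (al ^+ 2 + D * be ^+ 2) = qnorm al be.
  (* [- D] has the same size as [D], so [abs2_qnorm] also evaluates the form with the opposite
     sign. *)
  have N2 : abs2 (- D) = 2 by rewrite abs2N.
  by rewrite -(abs2_qnorm N2) mulNr opprK.
have P0 : al ^+ 2 + D * be ^+ 2 != 0.
  by rewrite -abs2_eq0 e gt_eqF// qnorm_gt0 ?al0.
exists (2 * (al * be) / (al ^+ 2 + D * be ^+ 2)).
  rewrite 3!abs2M abs2V e abs2_2 invfM; ring.
apply: (actsZ P0); move: (acts_comp hg hg); congr acts; first by ring.
by rewrite [RHS]mulrC divfK//; ring.
Qed.

(** The first square has |y| <= 1/2 because |al| |be| <= [qnorm al be], and [k] records its size.
    From then on [1 + D y^2] is a unit, so that each squaring halves |y|. *)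
Lemma acts_iter_squares (al be : Q2) g : al != 0 -> be != 0 -> acts al be g ->
  exists k : nat, forall n, exists j y,
    abs2 y = 2 ^- (k + n).+1 /\ acts 1 y (iter j g).
Proof.
move=> al0 be0 hg; have [y0 ey0 h0] := acts_square al0 be0 hg.
have a0 : 0 < abs2 al by rewrite abs2_gt0.
have b0 : 0 < abs2 be by rewrite abs2_gt0.
have y0n : y0 != 0.
  rewrite -abs2_gt0 ey0 divr_gt0 ?mulr_gt0// qnorm_gt0// al0//.
have y0le : abs2 y0 <= 2^-1.
  rewrite ey0 ler_pdivrMr ?mulr_gt0 ?qnorm_gt0 ?al0// mulKf//.
  rewrite /qnorm le_max; have [le|lt] := leP (abs2 be) (abs2 al); apply/orP.
    by left; rewrite expr2; nra.
  by right; rewrite expr2; nra.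
have [k ek] : exists k : nat, abs2 y0 = 2 ^- k.+1.
  have [[n|n] e] := abs2_pow y0n; last by exists n; rewrite e NegzE.
  move: y0le; rewrite e => h; exfalso.
  have := @exprn_ege1 rat n 2; move: h; rewrite -exprnP => h /(_ isT) h'; lra.
exists k; elim=> [|n [j [y [ey hy]]]].
  by exists 2, y0; rewrite addn0.
exists (j + j)%N.
have y0' : y != 0 by rewrite -abs2_gt0 ey invr_gt0 exprn_gt0.
have [y' ey' hy'] := acts_square (oner_neq0 _) y0' hy.
exists y'; split; last by move=> z p q r; rewrite iterD; exact: hy'.
have yle : abs2 y <= 2^-1.
  by rewrite ey exprS invfM ler_piMr// invf_le1 ?exprn_gt0// exprn_ege1.
rewrite ey' abs2_1 mul1r /qnorm abs2_1 expr1n max_l.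
  by rewrite mulr1 addnS [in RHS]exprSr invfM -ey.
have := abs2_ge0 y; nra.
Qed.

End Acts.

(** * The topology of the projective line through discs and cells *)

Lemma pow2_archi (e : rat) : 0 < e -> exists m, 2 ^- m < e.
Proof.
move=> e0; exists (Num.truncn e^-1).+1.
rewrite invf_plt ?posrE ?exprn_gt0// (lt_le_trans (truncnS_gt _))//.
by rewrite -natrX ler_nat ltnW// ltn_expl.
Qed.

Lemma ball_abs2 (x y : Q2) (e : rat) : ball x e y = (abs2 (x - y) < e) :> Prop.
Proof. by rewrite ballEmdist. Qed.

Lemma nbhs_abs2 (x : Q2) (U : set Q2) :
  nbhs x U <-> exists2 e, 0 < e & forall y, abs2 (x - y) < e -> U y.
Proof.
split=> [/nbhs_ballP[e /= e0 h]|[e e0 h]].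
  by exists e => // y xy; apply: h; rewrite ball_abs2.
apply/nbhs_ballP; exists e => //= y; rewrite ball_abs2; exact: h.
Qed.

Definition disc (x : Q2) (r : rat) : set Q2 := [set y | abs2 (y - x) <= r].

Lemma disc_subset x y r : disc x r y -> disc y r `<=` disc x r.
Proof. by move=> h z hz; rewrite /disc /= -(subrKA y) abs2D_le. Qed.

Lemma disc_sym x y r : disc x r y -> disc y r x.
Proof. by rewrite /disc /= abs2B. Qed.

Lemma open_disc x r : 0 < r -> open (disc x r).
Proof.
move=> r0; rewrite openE => y xy; apply/nbhs_abs2; exists r => // z yz.
by apply: (disc_subset xy); rewrite /disc /= abs2B ltW.
Qed.

Lemma closed_disc x r : 0 <= r -> closed (disc x r).
Proof.
move=> r0; rewrite -[disc x r]setCK; apply: open_closedC; rewrite openE => y xy.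
have {}xy : r < abs2 (y - x) by rewrite ltNge; apply/negP.
apply/nbhs_abs2; exists (abs2 (y - x)); first exact: le_lt_trans xy.
move=> z yz; rewrite /disc /=; apply/negP; rewrite -ltNge -(subrKA y) addrC.
by rewrite abs2D_eq// abs2B.
Qed.

(** An ultrafilter containing a disc contains one of half the radius: either the concentric one, or
    the sphere left over, which lies in a single such disc around any of its points. The centres
    form a Cauchy sequence, and completeness gives the limit. *)
Lemma compact_disc (k : nat) : compact (disc 0 (2 ^+ k)).
Proof.
rewrite compact_ultra => F FU F0.
have r0 n : 0 < (2 ^+ k / 2 ^+ n : rat) by rewrite divr_gt0 ?exprn_gt0.
have step n : exists x, F (disc x (2 ^+ k / 2 ^+ n)).
  elim: n => [|n [x Fx]]; first by exists 0; rewrite expr0 divr1.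
  have [Fh|Fh] := in_ultra_setVsetC (disc x (2 ^+ k / 2 ^+ n.+1)) FU; first by exists x.
  have [y [xy nxy]] := filter_ex (filterI Fx Fh).
  exists y; apply: filterS (filterI Fx Fh) => z [xz nxz].
  have half : 2 ^+ k / 2 ^+ n.+1 = 2 ^+ k / 2 ^+ n / 2 :> rat.
    by rewrite exprSr invfM mulrA.
  have e : abs2 (2 ^- k * 2 ^+ n) = 2 ^+ k / 2 ^+ n.
    by rewrite abs2M abs2V !abs2X abs2_2 !exprVn invrK.
  have sphere w : disc x (2 ^+ k / 2 ^+ n) w ->
      (~` disc x (2 ^+ k / 2 ^+ n.+1)) w -> abs2 (w - x) = 2 ^+ k / 2 ^+ n.
    rewrite /disc /= => hw nw; apply/eqP; rewrite eq_le hw /= leNgt.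
    by apply/negP => lt; apply: nw; rewrite half -e abs2_lt_half// e.
  rewrite /disc /= half -(sphere _ xz nxz); apply: abs2_dist_eq_half.
  by rewrite !sphere.
have [x Fx] := choice step.
have close m n : abs2 (x m - x n) <= Num.max (2 ^+ k / 2 ^+ m) (2 ^+ k / 2 ^+ n).
  have [y [hm hn]] := filter_ex (filterI (Fx m) (Fx n)).
  rewrite -(subrKA y) (le_trans (abs2D _ _))// ge_max !le_max.
  by rewrite (disc_sym hm) [X in _ && (_ || X)]hn orbT.
have small (e : rat) : 0 < e -> exists N, forall n, (N <= n)%N -> 2 ^+ k / 2 ^+ n < e.
  move=> e0; have [|N hN] := @pow2_archi (e / 2 ^+ k).
    by rewrite divr_gt0// exprn_gt0.
  exists N => n Nn; rewrite mulrC -ltr_pdivlMr ?exprn_gt0//.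
  rewrite (le_lt_trans _ hN)// lef_pV2 ?posrE ?exprn_gt0// ler_eXn2l//.
have [|l hl] := @abs2_complete x.
  move=> e /small[N hN]; exists N => m n Nm Nn.
  by rewrite (le_lt_trans (close m n))// gt_max !hN.
have Fl n : F (disc l (2 ^+ k / 2 ^+ n)).
  have [N hN] := hl _ (r0 n); pose M := maxn N n.
  apply: filterS (Fx M) => y hy; apply: (@disc_subset l (x M)).
    by rewrite /disc /= ltW// hN// leq_maxl.
  rewrite /disc /= (le_trans hy)// ler_pM2l ?exprn_gt0//.
  by rewrite lef_pV2 ?posrE ?exprn_gt0// ler_eXn2l// leq_maxr.
exists l; split.
  have [y [y0 yl]] := filter_ex (filterI F0 (Fl 0%N)).
  apply: (disc_subset y0); apply: disc_sym.
  by move: yl; rewrite expr0 divr1.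
move=> U /nbhs_abs2[e e0 hU]; have [N hN] := small e e0.
apply: filterS (Fl N) => y hy; apply: hU.
by rewrite abs2B (le_lt_trans hy)// hN.
Qed.

Lemma nbhs_Some (x : Q2) (U : set P1) : nbhs (Some x : P1) U <->
  exists2 e, 0 < e & forall y, abs2 (x - y) < e -> U (Some y).
Proof. exact: (nbhs_abs2 x (Some @^-1` U)). Qed.

Lemma nbhs_None (U : set P1) : nbhs (None : P1) U <->
  U None /\ exists r, forall y, r < abs2 y -> U (Some y).
Proof.
split=> [[C [cC _] CU]|[UN [r hr]]].
  split; first by apply: CU; right.
  (* A compact set is bounded: near each [y] the bound [n] holds on [disc y 1] for all large [n],
     and compactness makes [n] uniform. *)
  have /compact_near_coveringP /(_ nat \oo (fun n y => abs2 y <= n%:R) _) := cC.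
  case=> [y Cy|N _ hN].
    exists (disc y 1, [set n | (Num.truncn (abs2 y)).+1 <= n]%N) => [|[z n] /= [hz hn]].
      split; last by exists (Num.truncn (abs2 y)).+1.
      by apply: open_nbhs_nbhs; split; [exact: open_disc|rewrite /disc /= subrr abs2_0].
    rewrite -[z](subrK y) abs2D_le// ?(le_trans hz) ?ler1n//; first exact: leq_trans hn.
    by rewrite ltW// (lt_le_trans (truncnS_gt _))// ler_nat.
  exists N%:R => y hy; apply: CU; left; exists y => // Cy.
  by have := hN N (leqnn N) y Cy; rewrite leNgt hy.
have [|m hm] := @pow2_archi (Num.max r 1)^-1; first by rewrite invr_gt0 lt_max orbC.
exists (disc 0 (2 ^+ m)).
  by split; [exact: compact_disc|apply: closed_disc; rewrite exprn_ge0].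
case=> [y|] [] // [z hz] // [<-]; apply: hr.
have {}hz : 2 ^+ m < abs2 z by rewrite ltNge; apply/negP => h; apply: hz; rewrite /disc /= subr0.
move: hm; rewrite ltf_pV2 ?posrE ?exprn_gt0// ?lt_max ?ltr01 ?orbT// gt_max => /andP[rm _].
exact: lt_trans hz.
Qed.

Lemma abs2_gt1_nbhs (x y : Q2) : 1 < abs2 x -> abs2 (x - y) < abs2 x -> abs2 y = abs2 x.
Proof.
by move=> x1 xy; rewrite -[y](subKr x) abs2D_eq// abs2N.
Qed.

Lemma abs2_subV (x y : Q2) : x != 0 -> abs2 y = abs2 x ->
  abs2 (x^-1 - y^-1) = abs2 (x - y) / abs2 x ^+ 2.
Proof.
move=> x0 e; have y0 : y != 0 by rewrite -abs2_eq0 e abs2_eq0.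
have -> : x^-1 - y^-1 = (y - x) * (x^-1 * y^-1).
  by rewrite mulrBl mulrCA mulfV// mulr1 mulrA mulfV// mul1r.
by rewrite !abs2M !abs2V abs2B e expr2 invfM.
Qed.

Lemma nbhs_cell (z : P1) (U : set P1) :
  nbhs z U <-> exists m, cell m z `<=` U.
Proof.
have gt0 m : (0 : rat) < 2 ^- m by rewrite invr_gt0 exprn_gt0.
case: z => [x|]; last first.
  rewrite nbhs_None; split=> [[UN [r hr]]|[m hm]].
    have [m hm] := @pow2_archi (Num.max r 1)^-1 ltac:(by rewrite invr_gt0 lt_max orbC).
    exists m => -[y|] //= [/= hy]; rewrite -hy sub0r abs2N abs2V => hy'; apply: hr.
    have y0 : 0 < abs2 y by rewrite (lt_trans ltr01)// ltNge -hy.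
    move: hm; rewrite ltf_pV2 ?posrE ?exprn_gt0// ?lt_max ?ltr01 ?orbT// gt_max.
    case/andP=> rm _; move: hy'; rewrite lef_pV2 ?posrE ?exprn_gt0//; apply: lt_le_trans.
    by rewrite (lt_trans rm)// ltr_eXn2l.
  split; first exact/hm/same_cell_refl.
  exists (2 ^+ m.+1) => y hy; apply: hm.
  have y1 : (abs2 y <= 1) = false.
    by apply/negbTE; rewrite -ltNge (le_lt_trans _ hy)// exprn_ege1.
  split; rewrite /= y1// sub0r abs2N abs2V lef_pV2 ?posrE ?exprn_gt0//; first exact: ltW.
  exact: lt_trans hy.
rewrite nbhs_Some; have [x1|x1] := leP (abs2 x) 1.
  have scale y : abs2 (2 * x - 2 * y) = 2^-1 * abs2 (x - y).
    by rewrite -mulrBr abs2M abs2_2.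
  have scale2 y m : (abs2 (2 * x - 2 * y) <= 2 ^- m.+1) = (abs2 (x - y) <= 2 ^- m).
    by rewrite scale exprS invfM ler_pM2l.
  split=> [[e e0 he]|[m hm]].
    have [m hm] := pow2_archi e0; exists m => -[y|];
      rewrite /cell /= /same_cell /= x1; last by case.
    by case=> <-; rewrite scale2 => h; apply: he; exact: le_lt_trans hm.
  exists (2 ^- m) => // y xy; apply: hm.
  have y1 : abs2 y <= 1.
    rewrite -[y](subKr x) abs2D_le// abs2N (le_trans (ltW xy))//.
    by rewrite invf_le1 ?exprn_gt0// exprn_ege1.
  by split; rewrite /= x1 y1// scale2 ltW.
have x0 : 0 < abs2 x by exact: lt_trans x1.
have xn1 : (abs2 x <= 1) = false by rewrite leNgt x1.
have xn0 : x != 0 by rewrite -abs2_gt0.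
split=> [[e e0 he]|[m hm]].
  (* The second bound keeps infinity out of the cell and forces [abs2 y = abs2 x]; the first then
     becomes [e] once inversion has scaled distances by [abs2 x ^- 2]. *)
  have [m hm] := @pow2_archi (Num.min (e / abs2 x ^+ 2) (abs2 x)^-1)
    ltac:(by rewrite lt_min divr_gt0 ?exprn_gt0 ?invr_gt0).
  exists m => -[y|]; rewrite /cell /= /same_cell /= xn1; last first.
    case=> _; rewrite subr0 abs2V => h; exfalso.
    move: hm; rewrite lt_min => /andP[_]; apply/negP; rewrite -leNgt.
    rewrite (le_trans h)// lef_pV2 ?posrE ?exprn_gt0// ler_eXn2l//.
  case=> <- h; apply: he.
  have xy : abs2 (x^-1 - y^-1) < Num.min (e / abs2 x ^+ 2) (abs2 x)^-1.
    apply: le_lt_trans h _; apply: le_lt_trans hm.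
    by rewrite lef_pV2 ?posrE ?exprn_gt0// ler_eXn2l.
  move: xy; rewrite lt_min => /andP[xy1 xy2].
  have e1 : abs2 y = abs2 x.
    apply: invr_inj; rewrite -!abs2V -[y^-1](subKr x^-1) abs2D_eq//.
    by rewrite abs2N abs2V.
  by move: xy1; rewrite abs2_subV// ltr_pdivrMr ?exprn_gt0// divfK// expf_neq0// gt_eqF.
exists (Num.min (abs2 x) (2 ^- m.+1 * abs2 x ^+ 2)).
  by rewrite lt_min x0 mulr_gt0// exprn_gt0.
move=> y; rewrite lt_min => /andP[xy1 xy2]; apply: hm.
have e1 := abs2_gt1_nbhs x1 xy1.
have yn1 : (abs2 y <= 1) = false by rewrite e1.
split; rewrite /= xn1 yn1// abs2_subV//.
by rewrite ler_pdivrMr ?exprn_gt0// ltW.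
Qed.

Lemma open_cell m z : open (cell m z).
Proof.
rewrite openE => z' zz'; apply/nbhs_cell; exists m => w; exact: same_cell_trans.
Qed.

Lemma finite_cells m : exists s : seq P1, forall z, exists2 w, w \in s & same_cell m w z.
Proof.
have := @one_point_compactification_compact Q2; rewrite compact_cover.
case/(_ P1 setT (cell m)) => [z _|z _|D _ hD].
- exact: open_cell.
- by exists z => //; exact: same_cell_refl.
exists (finmap.enum_fset D) => z; have [w Dw wz] := hD z I.
by exists w.
Qed.

Lemma affine_continuous (eta t : Q2) : eta != 0 -> continuous (affine eta t).
Proof.
move=> e0; have ea : 0 < abs2 eta by rewrite abs2_gt0.
case=> [x|] U; rewrite ?[nbhs (affine _ _ _) _]/(nbhs (Some _) _) -/(nbhs _ _) /=.
  move=> /nbhs_Some[e e_gt0 he]; apply/nbhs_Some; exists (e / abs2 eta).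
    by rewrite divr_gt0.
  move=> y; rewrite ltr_pdivlMr// => xy; apply: he.
  have -> : eta * x + t - (eta * y + t) = (x - y) * eta by ring.
  by rewrite abs2M.
move=> /nbhs_None[UN [r hr]]; apply/nbhs_None; split=> //.
exists (Num.max r (abs2 t) / abs2 eta) => y.
rewrite ltr_pdivrMr// gt_max => /andP[ry ty]; apply: hr.
by rewrite abs2D_eq abs2M mulrC.
Qed.

Lemma inversion_Some_continuous : continuous (inversion \o (Some : Q2 -> P1)).
Proof.
move=> x U /=; case: eqVneq => [->|x0].
  move=> /nbhs_None[UN [r hr]]; apply/nbhs_abs2.
  exists (Num.max r 1)^-1; first by rewrite invr_gt0 lt_max orbC.
  move=> y; rewrite sub0r abs2N /inversion /=; case: eqVneq => // y0 hy; apply: hr.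
  rewrite abs2V; have ya : 0 < abs2 y by rewrite abs2_gt0.
  move: hy; rewrite -[X in X < _]invrK ltf_pV2 ?posrE ?invr_gt0// ?lt_max ?ltr01 ?orbT//.
  by rewrite gt_max => /andP[].
move=> /nbhs_Some[e e0 he]; have xa : 0 < abs2 x by rewrite abs2_gt0.
apply/nbhs_abs2; exists (Num.min (abs2 x) (e * abs2 x ^+ 2)).
  by rewrite lt_min xa mulr_gt0// exprn_gt0.
move=> y; rewrite lt_min => /andP[xy1 xy2].
have yx : abs2 y = abs2 x by rewrite -[y](subKr x) abs2D_eq// abs2N.
rewrite /inversion /= ifF; last by rewrite -abs2_eq0 yx abs2_eq0; exact: negbTE.
by apply: he; rewrite abs2_subV// ltr_pdivrMr ?exprn_gt0.
Qed.

(** * Borel measures on a space with a tree of cells *)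

Lemma continuous_borel (X Y : ptopologicalType) (f : X -> Y) :
  continuous f -> measurable_fun [set: borel X] (f : borel X -> borel Y).
Proof.
move=> cf; apply: (@measurability _ _ (borel X) (borel Y) setT f (@open Y)) => //.
move=> _ [U oU <-]; rewrite setTI; apply: sub_sigma_algebra.
by apply: open_comp => // x _; exact: cf.
Qed.

Lemma closed_borel (X : ptopologicalType) (B : set X) :
  closed B -> measurable (B : set (borel X)).
Proof.
move=> cB; rewrite -[B]setCK; apply: measurableC; apply: sub_sigma_algebra.
exact: closed_openC.
Qed.

(* E m is the m-th of a sequence of finer and finer finite clopen partitions that
   generate the topology; an isometry for the resulting ultrametric permutes the
   classes, and transitively so on a minimal set. *)
Section CellSystem.
Context (X : ptopologicalType) (E : nat -> X -> X -> Prop).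
Hypotheses (E_refl : forall m z, E m z z)
  (E_sym : forall m z z', E m z z' -> E m z' z)
  (E_trans : forall m z1 z2 z3, E m z1 z2 -> E m z2 z3 -> E m z1 z3)
  (E_le : forall m n z z', (m <= n)%N -> E n z z' -> E m z z')
  (E_nbhs : forall z (U : set X), nbhs z U <-> exists m, [set z' | E m z z'] `<=` U)
  (E_finite : forall m, exists s : seq X,
     forall z, exists2 w, w \in s & E m w z).

Let C m z : set X := [set z' | E m z z'].

Let C_eq m z z' : E m z z' -> C m z = C m z'.
Proof.
move=> zz'; apply/seteqP; split=> w /= h; first exact: E_trans (E_sym zz') h.
exact: E_trans zz' h.
Qed.

Let C_open m z : open (C m z).
Proof.
by rewrite openE => z' zz'; apply/E_nbhs; exists m => w; exact: E_trans.
Qed.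

Let C_measurable m z : measurable (C m z : set (borel X)).
Proof. exact: sub_sigma_algebra. Qed.

Section Measures.
Context (R : realType).

(** Two cells are nested or disjoint, whence stability under intersection. They generate the Borel
    sets because each level is finite, so that an open set is a countable union of cells. *)
Lemma cells_measure_unique (m1 m2 : {measure set (borel X) -> \bar R}) :
  (m1 setT < +oo)%E -> m1 setT = m2 setT ->
  (forall m z, m1 (C m z) = m2 (C m z)) ->
  forall A, measurable A -> m1 A = m2 A.
Proof.
move=> fin tot cells.
pose G : set (set (borel X)) := [set A | [\/ A = set0, A = setT | exists m z, A = C m z]].
have Gcell m z : G (C m z) by apply: Or33; exists m, z.
have genG : @measurable _ (borel X) = <<s G >>.
  apply/seteqP; split; last first.
    apply: smallest_sub; first exact: (@sigma_algebra_measurable _ (borel X)).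
    move=> A [->|->|[m [z ->]]]; [exact: measurable0|exact: measurableT|].
    exact: C_measurable.
  apply: smallest_sub; first exact: smallest_sigma_algebra.
  move=> U oU; have [s hs] := choice E_finite.
  (* The n-th cell of level m if it lies in [U], and [set0] otherwise, which gives a union indexed
     by [nat]. *)
  pose V m n : set X :=
    if (n < size (s m))%N && `[< C m (nth point (s m) n) `<=` U >]
    then C m (nth point (s m) n) else set0.
  have -> : U = \bigcup_m \bigcup_n V m n.
    apply/seteqP; split=> [z Uz|z [m _ [n _]]].
      have /E_nbhs[m hm] : nbhs z U by exact: open_nbhs_nbhs.
      have [w ws wz] := hs m z; exists m => //; exists (index w (s m)) => //.
      rewrite /V index_mem ws nth_index//= asboolT//.
      by move=> z' wz'; apply: hm; exact: E_trans (E_sym wz) wz'.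
    by rewrite /V; case: ifP => // /andP[_ /asboolP h]; exact: h.
  apply: sigma_algebra_bigcup => m; apply: sigma_algebra_bigcup => n.
  rewrite /V; case: ifP => _; first exact: sub_sigma_algebra.
  exact: sigma_algebra0.
apply: (measure_unique G (fun=> setT)) => //.
- move=> A B [->|->|[m [z ->]]]; first by rewrite set0I => _; apply: Or31.
    by rewrite setTI.
  case=> [->|->|[n [w ->]]]; [by rewrite setI0; apply: Or31|by rewrite setIT|].
  have [[y [zy wy]]|none] := pselect (exists y, (C m z `&` C n w) y); last first.
    by apply: Or31; apply/seteqP; split=> // y hy; exfalso; apply: none; exists y.
  rewrite (C_eq zy) (C_eq wy); have [mn|/ltnW nm] := leqP m n.
    by rewrite setIidr// => x /=; exact: E_le.
  by rewrite setIidl// => x /=; exact: E_le.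
- by move=> _; apply: Or32.
- by rewrite bigcup_const.
- by move=> A [->|->|[m [z ->]]]//; rewrite !measure0.
Qed.

Variables (phi : X -> X)
  (phi_cell : forall m z z', E m (phi z) (phi z') <-> E m z z')
  (phi_surj : forall z', exists z, phi z = z').

Let phi_preim m z : phi @^-1` C m (phi z) = C m z.
Proof. by apply/seteqP; split=> w /= /phi_cell. Qed.

Let phi_measurable : measurable_fun [set: borel X] (phi : borel X -> borel X).
Proof.
apply: continuous_borel => z U /E_nbhs[m hm]; apply/E_nbhs; exists m => w zw.
by apply: hm; apply/phi_cell.
Qed.

Let phi_measurable_preim (A : set (borel X)) :
  measurable A -> measurable (phi @^-1` A : set (borel X)).
Proof. by move=> mA; rewrite -[_ @^-1` _]setTI; exact: phi_measurable. Qed.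

Variables (B : set X) (hB : minimal_subsystem phi B).

Let B_measurable : measurable (B : set (borel X)).
Proof.
case: hB => -[[x Bx] _ _] /(_ x Bx) ->; apply: closed_borel.
exact: closed_closure.
Qed.

Let null_preim_stable (tau : probability (borel X) R) (A N : set (borel X)) :
  measurable A -> measurable N -> tau N = 0%E -> tau (A `\` N) = tau A.
Proof.
move=> mA mN N0; rewrite [RHS](measureDI tau mA mN).
rewrite [X in (_ + X)%E](_ : _ = 0%E) ?adde0//.
apply: (subset_measure0 _ mN) => //; exact: measurableI.
Qed.

Let supported (tau : probability (borel X) R) (A : set (borel X)) :
  tau B = 1%E -> measurable A -> tau (A `&` B) = tau A.
Proof.
move=> tauB mA; rewrite -[B]setCK -setDE null_preim_stable//.
  exact: measurableC.
by rewrite probability_setC// tauB subee.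
Qed.

(** [invariant_probability] speaks only of subsets of [B]; [tau] is carried by [B], so the
    invariance extends to all Borel sets. *)
Let invariant_preim (tau : probability (borel X) R) (A : set (borel X)) :
  invariant_probability phi B tau -> measurable A -> tau (phi @^-1` A) = tau A.
Proof.
move=> [tauB inv] mA; rewrite -[RHS]supported// -[RHS]inv; last 2 first.
- exact: measurableI.
- exact: subIsetr.
rewrite -[LHS]supported//; last exact: phi_measurable_preim.
congr (tau _); apply/seteqP; split=> z [/= h1 h2]; last by case: h2.
split=> //; split=> //; case: hB => -[_ _ phiB] _; apply: phiB; by exists z.
Qed.

Lemma invariant_cell_const (tau : probability (borel X) R) m z z' :
  invariant_probability phi B tau -> B z -> B z' -> tau (C m z) = tau (C m z').
Proof.
move=> inv Bz Bz'; case: hB => _ /(_ z Bz) dense; rewrite dense in Bz'.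
have [_ [[n _ <-] zn]] : (range (fun n => iter n phi z) `&` C m z') !=set0.
  by apply: Bz'; apply: open_nbhs_nbhs; split.
rewrite (C_eq zn) => {zn}; elim: n => // n ->.
by rewrite -(invariant_preim inv (C_measurable m (iter n.+1 phi z))) iterS phi_preim.
Qed.

(** Chosen from the class as a set, hence the same for equivalent points: [B_reps m] has one point
    for each cell that meets [B]. *)
Let rep m z : X := xget point (C m z).

Let repP m z : E m z (rep m z).
Proof. by apply: (xgetPex point (P := C m z)); exists z; exact: E_refl. Qed.

Let B_reps m : set X := [set rep m z | z in B].

Let B_reps_finite m : finite_set (B_reps m).
Proof.
have [s hs] := E_finite m.
apply: (@sub_finite_set _ _ [set rep m w | w in [set` s]]).
  move=> _ [z Bz <-]; have [w ws wz] := hs z; exists w => //.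
  by rewrite /rep (C_eq wz).
by apply: finite_image; exact: finite_seq.
Qed.

(** The cells that meet [B] are disjoint, cover it and have equal masses; their number does not
    depend on [tau], so neither does the common mass. *)
Let invariant_cell_count (tau : probability (borel X) R) m z :
  invariant_probability phi B tau -> B z ->
  fine (tau (C m z)) *+ size (finmap.enum_fset (fset_set (B_reps m))) = 1.
Proof.
move=> inv Bz; apply: (@EFin_inj R).
have tauU : tau (\bigcup_(w in B_reps m) C m w) = 1%E.
  apply/eqP; rewrite eq_le probability_le1//=; last first.
    exact: fin_bigcup_measurable.
  rewrite -[X in (X <= _)%E](proj1 inv) le_measure ?inE//.
    exact: fin_bigcup_measurable.
  by move=> w Bw; exists (rep m w); [exists w|exact: E_sym].
rewrite -[RHS]tauU measure_fin_bigcup//; last first.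
  move=> _ _ [w _ <-] [w' _ <-] [y [wy w'y]].
  by rewrite /rep (C_eq (E_trans (repP m w) wy)) (C_eq (E_trans (repP m w') w'y)).
rewrite (eq_fsbigr (fun=> (fine (tau (C m z)))%:E)); last first.
  move=> _ /[!inE] -[w Bw <-]; rewrite fineK ?fin_num_measure// -(C_eq (repP m w)).
  exact: invariant_cell_const.
by rewrite fsbig_finite//= sumEFin big_const_seq count_predT iter_addr_0.
Qed.

Lemma invariant_probability_unique (tau sigma : probability (borel X) R) :
  invariant_probability phi B tau -> invariant_probability phi B sigma ->
  forall A : set (borel X), measurable A -> tau A = sigma A.
Proof.
move=> ht hs; apply: cells_measure_unique => [||m z].
- by rewrite [X in (X < _)%E]probability_setT ltry.
- by rewrite [LHS]probability_setT [RHS]probability_setT.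
have [[w [zw Bw]]|none] := pselect (exists w, (C m z `&` B) w); last first.
  have CB0 : C m z `&` B = set0.
    by apply/seteqP; split=> // w hw; exfalso; apply: none; exists w.
  rewrite -[LHS](supported (proj1 ht) (C_measurable m z)).
  by rewrite -[RHS](supported (proj1 hs) (C_measurable m z)) CB0 !measure0.
rewrite (C_eq zw) -[LHS]fineK ?fin_num_measure// -[RHS]fineK ?fin_num_measure//.
have e1 := invariant_cell_count m ht Bw; have e2 := invariant_cell_count m hs Bw.
congr EFin.
apply: (@pmulrnI R (size (finmap.enum_fset (fset_set (B_reps m)))));
  last by rewrite e1 e2.
by rewrite lt0n; apply/eqP => n0; move: e1; rewrite n0 mulr0n => /esym/eqP; rewrite oner_eq0.
Qed.

(** The measure [mu] is invariant on the whole space, because its image under [phi] gives every cell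
    the same mass; the candidate on [B] is [mu] conditioned on [B]. *)
Lemma cell_invariant_conditional (mu : {measure set (borel X) -> \bar R}) :
  (mu setT < +oo)%E -> (forall m z z', mu (C m z) = mu (C m z')) ->
  mu B != 0%E ->
  exists sigma : probability (borel X) R, invariant_probability phi B sigma /\
    forall A : set (borel X), measurable A -> sigma A = (mu (A `&` B) / mu B)%E.
Proof.
move=> fin mu_cell muB0.
have muB_fin : mu B \is a fin_num.
  rewrite ge0_fin_numE// (le_lt_trans _ fin)// le_measure ?inE//.
have mu_phi (A : set (borel X)) : measurable A -> mu (phi @^-1` A) = mu A.
  pose nu : {measure set (borel X) -> \bar R} :=
    pushforward mu (phi : borel X -> borel X).
  move: A.
  apply: (@cells_measure_unique (nu phi_measurable) mu) => // m z.
  (* By surjectivity every cell is centred at some [phi w], and its preimage is then the cell of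
     [w]. *)
  have [w <-] := phi_surj z.
  rewrite -[LHS]/(mu (phi @^-1` C m (phi w))) phi_preim; exact: mu_cell.
pose P0 : probability (borel X) R := dirac (point : borel X).
have [sigma sigmaE] : exists sigma : probability (borel X) R,
    forall A, sigma A = (mu (A `&` B) / mu B)%E.
  exists (mnormalize (mrestr mu B_measurable) P0) => A.
  have evidence : mrestr mu B_measurable [set: borel X] = mu B.
    by rewrite /mrestr setTI.
  change (mnormalize (mrestr mu B_measurable) P0 A = mu (A `&` B) / mu B)%E.
  rewrite /mnormalize /= evidence (negPf muB0) /=.
  have -> /= : (mu B == +oo)%E = false by apply/eqP => h; move: muB_fin; rewrite h.
  have fine0 : fine (mu B) != 0 by rewrite fine_eq0.
  by rewrite -[in RHS](fineK muB_fin) inver (negPf fine0).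
exists sigma; split; last by move=> A _; exact: sigmaE.
split; first by rewrite sigmaE setIid divee.
move=> A mA AB; rewrite !sigmaE (setIidl AB) (setIC B) -setIA setIid; congr (_ / _)%E.
have mA' := phi_measurable_preim mA; have mB' := phi_measurable_preim B_measurable.
(* Only forward invariance of [B] is given. The excess [phi^-1 B \ B] is null, because [B] lies in
   [phi^-1 B] and both have the same finite mass. *)
have -> : phi @^-1` A `&` B = phi @^-1` A `\` (phi @^-1` B `\` B).
  apply/seteqP; split=> z [/= h1 h2]; split=> //; first by case.
  by apply: contrapT => nBz; apply: h2; split=> //; exact: AB.
have mN := measurableD mB' B_measurable.
rewrite -(mu_phi _ mA) [RHS](measureDI mu mA' mN).
rewrite [X in (_ + X)%E](_ : _ = 0%E) ?adde0//.
apply: (subset_measure0 _ mN) => //; first exact: measurableI.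
have muBoo : (mu (phi @^-1` B) < +oo)%E by rewrite mu_phi// ltey_eq muB_fin.
rewrite (measureD mB' B_measurable muBoo).
have BphiB : B `<=` phi @^-1` B.
  by case: hB => -[_ _ phiB] _ z Bz; apply: phiB; exists z.
have -> : phi @^-1` B `&` B = B by rewrite setIidr.
have := mu_phi B B_measurable; rewrite /preimage /= => ->.
by rewrite subee.
Qed.

End Measures.
End CellSystem.

(** * Masses of discs and cells *)

Lemma cell_Some m x : abs2 x <= 1 -> cell m (Some x) = Some @` disc x (2 ^- m).
Proof.
move=> x1.
have scale y : (abs2 (2 * x - 2 * y) <= 2 ^- m.+1) = (abs2 (y - x) <= 2 ^- m).
  by rewrite -mulrBr abs2M abs2_2 exprS invfM ler_pM2l// abs2B.
have m1 : (2 ^- m : rat) <= 1 by rewrite invf_le1 ?exprn_gt0// exprn_ege1.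
apply/seteqP; split=> [[y|] [/= i h]|_ [y xy <-]].
- by move: h; rewrite x1 -i x1 scale => xy; exists y.
- by move: i; rewrite x1.
have y1 : abs2 y <= 1 by rewrite -[y](subrK x) abs2D_le// (le_trans xy).
by split; rewrite /= ?x1 y1// scale.
Qed.

Section Haar.
Context (R : realType) (mu0 : probability (borel Q2) R) (hmu0 : haar_Z2 mu0).

Let disc_measurable (x : Q2) m : measurable (disc x (2 ^- m) : set (borel Q2)).
Proof. by apply: closed_borel; apply: closed_disc; rewrite invr_ge0 exprn_ge0. Qed.

Let pow_le1 m : (2 ^- m : rat) <= 1.
Proof. by rewrite invf_le1 ?exprn_gt0// exprn_ege1. Qed.

Let haar_disc_translate (x : Q2) m : Z2 x -> mu0 (disc x (2 ^- m)) = mu0 (disc 0 (2 ^- m)).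
Proof.
move=> Zx; case: hmu0 => _ /(_ x (disc 0 (2 ^- m)) Zx) <-//.
  congr (mu0 _); apply/seteqP; split=> [y xy|_ [y y0 <-]].
    by exists (y - x); [rewrite /disc /= subr0|rewrite addrC subrK].
  by move: y0; rewrite /disc /= subr0 addrAC subrr add0r.
by move=> y; rewrite /disc /= subr0 => /le_trans; apply.
Qed.

(** The disc around 0 is the disjoint union of two translates of the next one, centred at 0 and at
    [2 ^+ m], so the mass halves at each level. *)
Lemma haar_disc (x : Q2) m : Z2 x -> mu0 (disc x (2 ^- m)) = (2 ^- m)%:E.
Proof.
move=> /haar_disc_translate ->; elim: m => [|m ih].
  rewrite !expr0 !invr1 -(proj1 hmu0); congr (mu0 _).
  by apply/seteqP; split=> y; rewrite /disc /Z2 /= subr0.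
have e : abs2 (2 ^+ m) = 2 ^- m by rewrite abs2X abs2_2 exprVn.
have half : (2 ^- m.+1 : rat) = 2 ^- m / 2 by rewrite exprSr invfM.
have split_disc : disc 0 (2 ^- m) = disc 0 (2 ^- m.+1) `|` disc (2 ^+ m) (2 ^- m.+1).
  apply/seteqP; split=> y; rewrite /disc /= subr0 half.
    have [lt _|ge le] := ltP (abs2 y) (2 ^- m).
      by left; rewrite -e abs2_lt_half// e.
    right; rewrite -e; apply: abs2_eq_half.
    by apply/eqP; rewrite e eq_le le.
  have pos : (0 : rat) <= 2 ^- m by rewrite invr_ge0 exprn_ge0.
  case=> h; first lra.
  by rewrite -[y](subrK (2 ^+ m)) abs2D_le ?e//; lra.
have disj : disc 0 (2 ^- m.+1) `&` disc (2 ^+ m) (2 ^- m.+1) = set0 :> set Q2.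
  apply/seteqP; split=> // y []; rewrite /disc /= subr0 half => h1 h2.
  have : abs2 (2 ^+ m) <= 2 ^- m / 2.
    by rewrite -[2 ^+ m](subKr y) abs2D_le// abs2N.
  have : (0 : rat) < 2 ^- m by rewrite invr_gt0 exprn_gt0.
  by rewrite e; lra.
have Z2m : Z2 (2 ^+ m) by rewrite /Z2 /= e.
pose D0 : set Q2 := disc 0 (2 ^- m.+1); pose D1 : set Q2 := disc (2 ^+ m) (2 ^- m.+1).
have additive : mu0 (D0 `|` D1) = (mu0 D0 + mu0 D1)%E.
  by apply: measureU => //; exact: disc_measurable.
move: ih; rewrite split_disc additive (haar_disc_translate _ Z2m).
rewrite -/D0 -[mu0 D0]fineK ?fin_num_measure//; last exact: disc_measurable.
by rewrite -EFinD => -[h]; congr EFin; rewrite exprSr invfM -h; lra.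
Qed.

(** In [Z2] the cell is a disc of radius [2 ^- m], counted with weight 1/2; outside, inversion turns
    it into a disc of radius [2 ^- m.+1], counted with weight 1. The weight undoes the factor 2 of
    [chart]. *)
Lemma mu_bar_cell m z : mu_bar mu0 (cell m z) = (2 ^- m.+1)%:E.
Proof.
have S0 : Some @^-1` set0 = set0 :> set Q2 by rewrite preimage_set0.
rewrite /mu_bar; case iz: (integral z).
  case: z iz => // x /= x1; rewrite cell_Some//.
  have sub : Some @` disc x (2 ^- m) `<=` Some @` Z2.
    apply: image_subset => y xy; rewrite /Z2 /= -[y](subrK x) abs2D_le//.
    exact: le_trans xy _.
  rewrite (setIidr sub) (_ : ~` _ `&` _ = set0); last first.
    by apply/seteqP; split=> // y [/= ny /sub].
  rewrite !preimage_set0 measure0 adde0 (_ : Some @^-1` _ = disc x (2 ^- m)).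
    by rewrite haar_disc// -EFinM exprS invfM.
  by apply/seteqP; split=> [y [w xw [<-]]|y xy]//; exists y.
have out : cell m z `<=` ~` (Some @` Z2).
  by move=> w [h _] [y Zy yw]; move: h; rewrite iz -yw /= [abs2 y <= 1]Zy.
rewrite (setIidr out) (_ : Some @` Z2 `&` _ = set0); last first.
  by apply/seteqP; split=> // y [/= Zy /out].
have cz := abs2_chart z.
rewrite preimage_set0 measure0 mule0 add0e.
rewrite (_ : Some @^-1` _ = disc (chart z) (2 ^- m.+1)).
  by rewrite haar_disc// /Z2 /= (le_trans cz)// invf_le1.
have inner y : abs2 y <= 2^-1 -> integral (inversion (Some y)) = false /\
    chart (inversion (Some y)) = y.
  rewrite -abs2_lt1 /= => y1; case: eqVneq => [->|y0]//=.
  by rewrite abs2V invf_le1 ?abs2_gt0// leNgt y1 /= invrK.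
apply/seteqP; split=> [y [h1 h2]|y h].
  have y1 : abs2 y <= 2^-1.
    rewrite -abs2_lt1 ltNge; apply/negP => y1; move: h1; rewrite iz /=.
    have y0 : 0 < abs2 y by exact: lt_le_trans y1.
    by rewrite -abs2_eq0 gt_eqF//= abs2V invf_le1// y1.
  by move: h2; rewrite (inner y y1).2 /disc /= abs2B.
have y1 : abs2 y <= 2^-1.
  rewrite -[y](subrK (chart z)) abs2D_le// (le_trans h)//.
  by rewrite exprS invfM ler_piMr// invf_le1 ?exprn_gt0// exprn_ege1.
have [e1 e2] := inner y y1.
by split; rewrite ?e1 ?e2// abs2B.
Qed.

End Haar.

(** * The set function [mu_bar] as a measure, transported by the affine map *)

Section MuBar.
Context (R : realType) (mu0 : probability (borel Q2) R).
Variables (eta t : Q2) (eta0 : eta != 0).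

Let mf1 : measurable_fun [set: borel Q2] (affine eta t \o Some : borel Q2 -> borel P1).
Proof.
apply: continuous_borel => x; apply: continuous_comp.
  exact: one_point_compactification_some_continuous.
exact: affine_continuous.
Qed.

Let mf2 : measurable_fun [set: borel Q2]
  (affine eta t \o (inversion \o Some) : borel Q2 -> borel P1).
Proof.
apply: continuous_borel => x; apply: continuous_comp.
  exact: inversion_Some_continuous.
exact: affine_continuous.
Qed.

Let Z2_measurable : measurable (Z2 : set (borel Q2)).
Proof.
rewrite (_ : Z2 = disc 0 1); last first.
  by apply/seteqP; split=> y; rewrite /disc /Z2 /= subr0.
by apply: closed_borel; exact: closed_disc.
Qed.

Let inner_measurable : measurable ((inversion \o Some) @^-1` (~` (Some @` Z2)) : set (borel Q2)).
Proof.
rewrite (_ : _ @^-1` _ = disc 0 2^-1); first by apply: closed_borel; exact: closed_disc.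
apply/seteqP; split=> y; rewrite /disc /= subr0 -abs2_lt1; case: eqVneq => [->|y0].
- by rewrite abs2_0.
- move=> h; rewrite ltNge; apply/negP => y1; apply: h; exists y^-1 => //.
  by rewrite /Z2 /= abs2V invf_le1// abs2_gt0.
- by move=> _ [].
- move=> y1 [z Zz [e]]; move: Zz; rewrite /Z2 /= e abs2V invf_le1 ?abs2_gt0//.
  by rewrite leNgt y1.
Qed.

(** Half the image of the Haar measure on [Z2], plus the image under inversion of its restriction to
    the disc of radius 1/2, both followed by the affine map. *)
Lemma mu_bar_measure : exists mu : {measure set (borel P1) -> \bar R},
  (mu setT < +oo)%E /\ forall A, mu A = mu_bar mu0 (affine eta t @^-1` A).
Proof.
pose h1 : {measure set (borel P1) -> \bar R} :=
  pushforward (mrestr mu0 Z2_measurable) (affine eta t \o Some : borel Q2 -> borel P1).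
pose h2 : {measure set (borel P1) -> \bar R} :=
  pushforward (mrestr mu0 inner_measurable)
    (affine eta t \o (inversion \o Some) : borel Q2 -> borel P1).
have half_ge0 : 0 <= (2^-1 : R) by [].
exists (measure_add (mscale (NngNum half_ge0) (h1 mf1)) (h2 mf2)).
have fin (A : set (borel Q2)) : measurable A -> (mu0 A < +oo)%E.
  by move=> mA; rewrite ltey_eq fin_num_measure.
split=> [|A].
  rewrite [X in (X < _)%E](measure_addE (mscale (NngNum half_ge0) (h1 mf1)) (h2 mf2)).
  apply: lte_add_pinfty.
    apply: lte_mul_pinfty => //; apply: fin.
    by apply: measurableI => //; rewrite preimage_setT.
  by apply: fin; apply: measurableI => //; rewrite preimage_setT.
apply: etrans; first exact: measure_addE.
rewrite /mscale /mu_bar /=; congr (_ * _ + _)%E.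
  rewrite /h1 /= /pushforward /mrestr; congr (mu0 _).
  apply/seteqP; split=> y [hA hZ]; split=> //.
  by case: hA => w Zw [<-].
by rewrite /h2 /= /pushforward /mrestr setIC.
Qed.

End MuBar.

(** * Conjugation to a multiplication, and density of orbits in a cell *)

(** The translation [t] equalises the diagonal entries of the matrix, to half the trace. The
    off-diagonal entries then have product Delta / 4; the lower one is [c * eta], and [D] is the
    ratio of the upper to the lower. *)
Lemma conjugate_translation_scaling (F : fieldType) (a b c d eta p q : F) :
  2 != 0 :> F -> c != 0 -> eta != 0 ->
  let t := (a - d) / (2 * c) in
  eta^-1 * (a * (eta * p + t * q) + b * q) +
    (- t / eta) * (c * (eta * p + t * q) + d * q) =
    (a + d) / 2 * p +
      ((d - a) ^+ 2 + 4 * b * c) / (4 * c ^+ 2 * eta ^+ 2) * (c * eta) * q /\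
  c * (eta * p + t * q) + d * q = c * eta * p + (a + d) / 2 * q.
Proof.
move=> two0 c0 eta0 t; rewrite /t.
have four0 : 4 != 0 :> F by rewrite (_ : 4 = 2 * 2) ?mulf_neq0//; ring.
by split; field; rewrite ?two0 ?four0 ?c0 ?eta0.
Qed.

Lemma acts_conjugate (a b c d eta : Q2) : a * d - b * c != 0 -> c != 0 -> eta != 0 ->
  let t := (a - d) / (2 * c) in
  acts (((d - a) ^+ 2 + 4 * b * c) / (4 * c ^+ 2 * eta ^+ 2)) ((a + d) / 2) (c * eta)
    (affine eta^-1 (- t / eta) \o homography a b c d \o affine eta t).
Proof.
move=> had c0 eta0 t z p q r.
have two0 : 2 != 0 :> Q2 by rewrite -abs2_eq0 abs2_2.
have [<- <-] := @conjugate_translation_scaling _ a b c d eta p q two0 c0 eta0.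
apply: represents_affine; first by rewrite invr_eq0.
exact/represents_homography/represents_affine.
Qed.

(* Each iterate g ^ (2 ^ n) moves all points by one and the same power of 2,
   halved at each step: an orbit enters both halves of each small cell that it
   meets. *)
Lemma orbit_dense_cell (D : Q2) (D2 : abs2 D = 2) (al be : Q2) (g : P1 -> P1) :
  al != 0 -> be != 0 -> acts D al be g ->
  exists k, forall z w m, same_cell k z w ->
    exists n, same_cell m w (iter n g z).
Proof.
move=> al0 be0 hg; have [k hk] := acts_iter_squares D2 al0 be0 hg.
exists k => z w m zw.
suff h j : exists n, same_cell (k + j) w (iter n g z).
  by have [n hn] := h m; exists n; exact: same_cell_le (leq_addl _ _) hn.
elim: j => [|j [n hn]]; first by exists 0%N; rewrite addn0; exact: same_cell_sym.
have [near|far] := pselect (same_cell (k + j).+1 w (iter n g z)).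
  by exists n; rewrite addnS.
have [i [y [ey hy]]] := hk j.
have y1 : abs2 y <= 2^-1.
  by rewrite ey exprS invfM ler_piMr// invf_le1 ?exprn_gt0// exprn_ege1.
(* The orbit point is in the wrong half of the cell, and this iterate moves it by exactly the
   distance between the halves: [w] and the new point both lie in the other half. *)
exists (i + n)%N; rewrite addnS iterD.
apply: (same_cell_split (same_cell_sym hn)).
- by apply/(acts_displacement D2 _ _ y1 hy); rewrite ey.
- by move=> /same_cell_sym.
- move=> /(acts_displacement D2 _ _ y1 hy); rewrite ey; apply/negP; rewrite -ltNge.
  by rewrite ltf_pV2 ?posrE ?exprn_gt0// ltr_eXn2l.
Qed.

Theorem theorem6p6 (R : realType)
    (a b c d : Q2) (had : a * d - b * c != 0)
    (L : fieldExtType Q2) (absL : L -> R) (habsL : abs2_extension absL)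
    (sqrtDelta : L)
    (hsqrtDelta : sqrtDelta ^+ 2 = ((d - a) ^+ 2 + 4 * b * c)%:A)
    (hirr : sqrtDelta \notin 1%VS)
    (hlambda : ~ exists2 n : nat, (0 < n)%N &
       n.-unity_root (((a + d)%:A + sqrtDelta) / ((a + d)%:A - sqrtDelta)))
    (i : int) (hi : i \in [:: 2; -2; 6; -6])
    (sqrti : L) (hsqrti : sqrti ^+ 2 = i%:~R)
    (hK : <<1; sqrtDelta>>%VS = <<1; sqrti>>%VS)
    (eta : Q2)
    (heta : ratr (abs2 eta) = Num.sqrt 2 * absL (sqrtDelta / c%:A))
    (mu0 : probability (borel Q2) R) (hmu0 : haar_Z2 mu0)
    (B : set P1) (hB : minimal_subsystem (homography a b c d) B) :
  let h := affine eta ((a - d) / (2 * c)) in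
  exists sigma : probability (borel P1) R,
    [/\ invariant_probability (homography a b c d) B sigma,
        (forall tau : probability (borel P1) R,
           invariant_probability (homography a b c d) B tau ->
           forall A : set (borel P1), measurable A -> A `<=` B ->
             tau A = sigma A)
      & forall A : set (borel P1), measurable A -> A `<=` B ->
          sigma A = (mu_bar mu0 (h @^-1` A) / mu_bar mu0 (h @^-1` B))%E].
Proof.
set t := (a - d) / (2 * c) => h.
pose Delta := (d - a) ^+ 2 + 4 * b * c.
have two0 : 2 != 0 :> Q2 by rewrite -abs2_eq0 abs2_2.
have s0 : sqrtDelta != 0 by apply: contraNneq hirr => ->; exact: mem0v.
(* If [c = 0], then [Delta] is the square of [d - a] and [sqrtDelta] lies in the base field. *)
have c0 : c != 0.
  apply: contraNneq hirr => c0; move: hsqrtDelta.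
  rewrite c0 mulr0 addr0 -[_%:A]/(in_alg L _) rmorphXn /= => /eqP.
  rewrite eqf_sqr => /orP[] /eqP ->; rewrite ?rpredN; apply: memvZ; exact: mem1v.
(* With zero trace the ratio lambda would be -1, a root of unity of order 2. *)
have al0 : (a + d) / 2 != 0.
  rewrite mulf_neq0 ?invr_eq0//; apply/eqP => ad0; apply: hlambda; exists 2 => //.
  rewrite unity_rootE ad0 scale0r add0r sub0r invrN mulrN divff// sqrrN expr1n.
  exact: eqxx.
have eta2 : abs2 eta ^+ 2 = 2 * (abs2 Delta / abs2 c ^+ 2).
  apply: (fmorph_inj (ratr : rat -> R)); rewrite rmorphXn /= heta exprMn sqr_sqrtr//.
  rewrite rmorphM /= ratr_nat expr2 -(abs2_extM habsL) -expr2 expr_div_n hsqrtDelta.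
  rewrite -abs2X -abs2V -abs2M -(abs2_extE habsL); congr (_ * absL _).
  by rewrite -![_%:A]/(in_alg L _) fmorph_div rmorphXn.
have Delta0 : 0 < abs2 Delta.
  rewrite abs2_gt0; apply: contraNneq s0 => D0.
  by rewrite -sqrf_eq0 hsqrtDelta -/Delta D0 scale0r.
have ca : 0 < abs2 c by rewrite abs2_gt0.
have eta0 : eta != 0.
  rewrite -abs2_eq0 -sqrf_eq0 eta2 gt_eqF//.
  by rewrite mulr_gt0// divr_gt0// exprn_gt0.
have be0 : c * eta != 0 by rewrite mulf_neq0.
pose D := Delta / (4 * c ^+ 2 * eta ^+ 2).
have D2 : abs2 D = 2.
  have e4 : abs2 4 = 4^-1 by rewrite (_ : 4 = 2 * 2 :> Q2) ?abs2M ?abs2_2//; ring.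
  rewrite /D abs2M abs2V (abs2M _ (eta ^+ 2)) (abs2M 4) !abs2X e4 eta2.
  by field; rewrite !gt_eqF.
pose hinv := affine eta^-1 (- t / eta).
have hinvK : cancel h hinv by exact: affineK.
have hVK : cancel hinv h by exact: affineVK.
pose phi := homography a b c d.
have psi_acts : acts D ((a + d) / 2) (c * eta) (hinv \o phi \o h).
  exact: acts_conjugate.
have nz : ((a + d) / 2 != 0) || (c * eta != 0) by rewrite al0.
have phiE z : hinv (phi z) = (hinv \o phi \o h) (hinv z) by rewrite /= hVK.
have iterE n z : hinv (iter n phi z) = iter n (hinv \o phi \o h) (hinv z).
  by elim: n => // n ih; rewrite !iterS phiE ih.
(* The cells are transported by [h], so that [phi], [B] and the measures on it need no transport. *)
pose E m z z' := same_cell m (hinv z) (hinv z').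
have E_nbhs z (U : set P1) : nbhs z U <-> exists m, [set z' | E m z z'] `<=` U.
  split=> [zU|[m hm]].
    have : nbhs (hinv z) (h @^-1` U).
      by apply: (affine_continuous eta0); rewrite -/h hVK.
    move=> /nbhs_cell[m hm]; exists m => w /hm; by rewrite /preimage /= hVK.
  have : nbhs z (hinv @^-1` (cell m (hinv z))).
    apply: affine_continuous; first by rewrite invr_eq0.
    by apply/nbhs_cell; exists m.
  by apply: filterS => w; exact: hm.
have E_finite m : exists s : seq P1, forall z, exists2 w, w \in s & E m w z.
  have [s hs] := finite_cells m; exists (map h s) => z.
  have [w ws wz] := hs (hinv z); exists (h w); first exact: map_f.
  by rewrite /E hinvK.
have phi_cell m z z' : E m (phi z) (phi z') <-> E m z z'.
  by rewrite /E (phiE z) (phiE z'); exact: (acts_cell D2 _ _ _ nz psi_acts).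
have phi_surj z' : exists z, phi z = z'.
  have [w hw] := acts_surj D2 nz psi_acts (hinv z'); exists (h w).
  exact: (can_inj hVK).
have E_refl m z : E m z z by exact: same_cell_refl.
have E_sym m z z' : E m z z' -> E m z' z by exact: same_cell_sym.
have E_trans m z1 z2 z3 : E m z1 z2 -> E m z2 z3 -> E m z1 z3.
  exact: same_cell_trans.
have E_le m n z z' : (m <= n)%N -> E n z z' -> E m z z' by exact: same_cell_le.
have [mu [mu_fin muE]] := mu_bar_measure mu0 t eta0.
have mu_cell m z : mu [set z' | E m z z'] = (2 ^- m.+1)%:E.
  rewrite muE -(mu_bar_cell hmu0 m (hinv z)); congr (mu_bar mu0 _).
  by apply/seteqP; split=> w; rewrite /E /cell /= -/h hinvK.
have [k hk] := orbit_dense_cell D2 al0 be0 psi_acts.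
have muB0 : mu B != 0%E.
  have [[[z0 Bz0] _ _] /(_ z0 Bz0) BE] := hB.
  (* Every point of this cell is a limit of the orbit of [z0], whose closure is [B]. *)
  have sub : [set z' | E k z0 z'] `<=` B.
    move=> z' zz'; rewrite BE => U /E_nbhs[m hm].
    have [n hn] := hk _ _ m zz'; exists (iter n phi z0); split; first by exists n.
    by apply: hm; rewrite /E /= iterE.
  apply/eqP => muB; have : (mu [set z' | E k z0 z'] <= mu B)%E.
    rewrite le_measure ?inE//; last by rewrite BE; apply: closed_borel; exact: closed_closure.
    apply: sub_sigma_algebra; rewrite openE => w zw; apply/E_nbhs; exists k => y.
    exact: E_trans.
  by rewrite muB mu_cell lee_fin leNgt invr_gt0 exprn_gt0.
have [sigma [inv sigmaE]] := cell_invariant_conditional E_sym E_trans E_le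
  E_nbhs E_finite phi_cell phi_surj hB mu_fin
  (fun m z z' => etrans (mu_cell m z) (esym (mu_cell m z'))) muB0.
exists sigma; split=> // [tau htau A mA _|A mA AB].
  exact: (invariant_probability_unique E_refl E_sym E_trans E_le E_nbhs E_finite phi_cell hB).
by rewrite sigmaE// (setIidl AB) !muE.
Qed.
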